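(* Let $M$ be an oriented matroid. A generic circuit signature of $M$ is triangulating if and only if it is induced by a generic single-element lifting of $M$. Dually, a generic cocircuit signature of $M$ is triangulating if and only if it is induced by a generic single-element extension of $M$.
   Context: Oriented matroids are finite; $E$ is the ground set of $M$ and $r$ its rank. ''Circuit'' and ''cocircuit'' without the word ''signed'' refer to the underlying matroid; $\underline X$ is the support of a signed set $X$. For a basis $B$: if $e\notin B$, $C(B,e)$ is the unique circuit contained in $B\cup e$; if $e\in B$, $C^*(B,e)$ is the unique cocircuit disjoint from $B\setminus e$. A single-element extension of $M$ is an oriented matroid $M'$ of rank $r$ on $E\sqcup\{f\}$ with $M=M'\setminus f$; it is generic if every circuit of $M'$ containing $f$ is spanning. A single-element lifting of $M$ is an oriented matroid $\widetilde M$ of rank $r+1$ on $E\sqcup\{g\}$ with $M=\widetilde M/g$; it is generic if every cocircuit of $\widetilde M$ containing $g$ has independent complement. A generic cocircuit signature of $M$ is a map $\sigma^*$ from the signed cocircuits of $M$ to $\{+,-\}$ with $\sigma^*(-D)=-\sigma^*(D)$; generic circuit signatures $\sigma$ are defined analogously on signed circuits. For an unsigned circuit $\underline C$ (resp. cocircuit $\underline D$), $\sigma(\underline C)$ (resp. $\sigma^*(\underline D)$) denotes the one of the two signed circuits (resp. cocircuits) with that support on which the signature is $+$. A generic extension $M'$ induces the generic cocircuit signature $\sigma^*(D):=D'(f)$, where $D'$ is the unique signed cocircuit of $M'$ with $D'|_E=D$. A generic lifting $\widetilde M$ induces the generic circuit signature $\sigma(C):=\widetilde C(g)$, where $\widetilde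 C$ is the unique signed circuit of $\widetilde M$ with $\widetilde C|_E=C$. Let $\overline E=\{\overline e:e\in E\}$ be a disjoint copy of $E$ and $\mathcal E=E\sqcup\overline E$. A sign vector $X:E\to\{+,-,0\}$ is interpreted as the subset of $\mathcal E$ containing $e$ if $X(e)=+$ and $\overline e$ if $X(e)=-$. Given a generic circuit signature $\sigma$ and a basis $B$ of $M$, $B^\sigma\subset\mathcal E$ is the set containing both $e$ and $\overline e$ for each $e\in B$, and, for each $e\notin B$, containing $e$ (resp. $\overline e$) if $e$ is positive (resp. negative) in $\sigma(C(B,e))$. The signature $\sigma$ is triangulating if, for every basis $B$ of $M$, $B^\sigma$ does not contain any signed circuit of $M$ of the form $-\sigma(\underline C)$, $\underline C$ a circuit (interpreted as a subset of $\mathcal E$). A generic cocircuit signature $\sigma^*$ of $M$ is a generic circuit signature of the dual $M^*$, and it is triangulating if it is so as a circuit signature of $M^*$: i.e. for every basis $B$ of $M$, the set $(E\setminus B)^{\sigma^*}$, which contains $e,\overline e$ for $e\in E\setminus B$ and, for $e\in B$, contains $e$ (resp. $\overline e$) if $e$ is positive (resp. negative) in $\sigma^*(C^*(B,e))$, contains no signed cocircuit of the form $-\sigma^*(\underline D)$. *)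

(* Defs.v *)
From mathcomp Require Import all_boot.

Set Implicit Arguments.
Unset Strict Implicit.
Unset Printing Implicit Defensive.

(* Signs: [Some true] is +, [Some false] is -, [None] is 0. *)
Definition sign := option bool.
Definition sopp (s : sign) : sign := omap negb s.

Notation svec E := {ffun E -> sign}.

Section SignVectors.
Variable E : finType.
Implicit Types (X Y : svec E) (C : {set svec E}) (A S D : {set E}).

Definition vopp X : svec E := [ffun e => sopp (X e)].
Definition supp X : {set E} := [set e | X e != None].
Definition pos X : {set E} := [set e | X e == Some true].
Definition neg X : {set E} := [set e | X e == Some false].

Definition orthogonal X Y : bool :=
  (supp X :&: supp Y == set0) ||
  [exists e in supp X :&: supp Y, X e == Y e] &&
  [exists e in supp X :&: supp Y, X e == sopp (Y e)].

(* The disjoint union of E and its copy is E * bool: (e, true) stands for e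
   and (e, false) for its copy. *)
Definition as_subset X : {set E * bool} := [set p | X p.1 == Some p.2].

Definition min_support C : {set svec E} :=
  [set X in C | minset [pred S : {set E} | S \in supp @: C] (supp X)].

End SignVectors.

Record oriented_matroid (E : finType) := OrientedMatroid {
  circuits : {set svec E};
  circuits_neq0 : forall X, X \in circuits -> supp X != set0;
  circuits_opp : forall X, X \in circuits -> vopp X \in circuits;
  circuits_incomp : forall X Y, X \in circuits -> Y \in circuits ->
        supp X \subset supp Y -> X = Y \/ X = vopp Y;
  circuits_elim : forall X Y e, X \in circuits -> Y \in circuits -> X <> vopp Y ->
        e \in pos X :&: neg Y ->
        exists2 Z, Z \in circuits &
          pos Z \subset (pos X :|: pos Y) :\ e /\
          neg Z \subset (neg X :|: neg Y) :\ e
}.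

Section Underlying.
Variables (E : finType) (M : oriented_matroid E).
Implicit Types (I B S D : {set E}).

Definition ucircuits : {set {set E}} := @supp E @: circuits M.

Definition indep I : bool := [forall C in ucircuits, ~~ (C \subset I)].

Definition basis B : bool := maxset indep B.

Definition rank_of S : nat := \max_(I : {set E} | indep I && (I \subset S)) #|I|.

Definition rank : nat := rank_of setT.

Definition spanning S : bool := rank_of S == rank.

(* Circuits of the dual matroid, whose bases are the complements of the
   bases: the minimal sets contained in no such complement. *)
Definition ucocircuits : {set {set E}} :=
  [set D | minset [pred S : {set E} | [forall (B : {set E} | basis B),
                               ~~ (S \subset ~: B)]] D].

(* The signed circuits of the dual oriented matroid: each underlying cocircuit
   carries exactly two signings orthogonal to all signed circuits. *)
Definition cocircuits : {set svec E} :=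
  [set Y | (supp Y \in ucocircuits) &&
           [forall X in circuits M, orthogonal X Y]].

End Underlying.

Section Signatures.
Variable E : finType.

(* C is the family of signed circuits, or of signed cocircuits, of an oriented
   matroid on E; the values of sigma outside C are irrelevant. *)
Variables (C : {set svec E}) (sigma : svec E -> bool).
Implicit Types A D : {set E}.

Definition generic_signature : Prop :=
  forall X, X \in C -> sigma (vopp X) = ~~ sigma X.

Definition chosen D : svec E :=
  odflt [ffun=> None] [pick X in C | (supp X == D) && sigma X].

Definition fundamental A (e : E) : {set E} :=
  odflt set0 [pick D in @supp E @: C | D \subset e |: A].

Definition sig_set A : {set E * bool} :=
  [set p | (p.1 \in A) || (chosen (fundamental A p.1) p.1 == Some p.2)].

Definition avoids A : Prop :=
  forall D, D \in @supp E @: C ->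
    ~~ (as_subset (vopp (chosen D)) \subset sig_set A).

End Signatures.

Section TriangulatingSignatures.
Variables (E : finType) (M : oriented_matroid E) (sigma : svec E -> bool).

Definition generic_circuit_signature := generic_signature (circuits M) sigma.
Definition generic_cocircuit_signature :=
  generic_signature (cocircuits M) sigma.

Definition triangulating_circuit_signature : Prop :=
  forall B, basis M B -> avoids (circuits M) sigma B.

(* For e in B, the cocircuit disjoint from B :\ e is the one contained in
   e |: ~: B. *)
Definition triangulating_cocircuit_signature : Prop :=
  forall B, basis M B -> avoids (cocircuits M) sigma (~: B).

End TriangulatingSignatures.

(* The ground set with one new element is [option E], the new element being
   [None]. *)
Section SingleElement.
Variable E : finType.
Implicit Types (M : oriented_matroid E) (N : oriented_matroid (option E)).

Definition restr (X : svec (option E)) : svec E := [ffun e => X (Some e)].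

Definition deletion_circuits N : {set svec E} :=
  [set restr X | X in circuits N & None \notin supp X].

Definition contraction_circuits N : {set svec E} :=
  min_support [set restr X | X in circuits N & supp (restr X) != set0].

Definition extension M N : Prop :=
  rank N = rank M /\ circuits M = deletion_circuits N.

Definition lifting M N : Prop :=
  rank N = (rank M).+1 /\ circuits M = contraction_circuits N.

Definition generic_extension M N : Prop :=
  extension M N /\
  forall C, C \in ucircuits N -> None \in C -> spanning N C.

Definition generic_lifting M N : Prop :=
  lifting M N /\
  forall D, D \in ucocircuits N -> None \in D -> indep N (~: D).

Definition induced (C : {set svec E}) (C' : {set svec (option E)})
    (sigma : svec E -> bool) : Prop :=
  forall X, X \in C ->
    exists2 X', unique (fun Y => Y \in C' /\ restr Y = X) X' &
                X' None = Some (sigma X).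

Definition induced_by_lifting M N sigma :=
  induced (circuits M) (circuits N) sigma.
Definition induced_by_extension M N sigma :=
  induced (cocircuits M) (cocircuits N) sigma.

End SingleElement.

(* Main.v *)
Require Import Defs.
From mathcomp Require Import all_boot.

(* Both families of signed circuits and cocircuits are recognised by
   orthogonality together with the painting property, a symmetric condition,
   so elimination comes for free and the statement on extensions is the dual
   of the statement on liftings.

   Let V X be the circuit X extended by sigma X at the new element.  The set
   B^sigma, completed by the sign - at the new element, is a sign vector whose
   zero set is B; it is orthogonal to V X for all circuits X exactly when
   B^sigma contains no -sigma(C).  In a generic lifting inducing sigma these
   vectors are the cocircuits through the new element.  Conversely, if they all
   are orthogonal to the V X, then up to sign they form, with the cocircuits of
   M, the cocircuits of a lifting: the elimination property follows from a
   painting argument at the new element and from painting in M. *)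

Set Implicit Arguments.
Unset Strict Implicit.
Unset Printing Implicit Defensive.

(** The lifting is built through its cocircuits because only these have an explicit description: one
    pair of opposite vectors over each basis, besides the cocircuits of [M]. The circuits of a
    lifting that avoid the new element are not directly visible from [sigma]. The cocircuits are
    therefore made the circuits of an oriented matroid, and the lifting is its dual. This needs
    duality in full. The obstacle there is existence: the definition of [cocircuits] selects
    orthogonal signings of an underlying cocircuit but does not supply one. Once [dual_pair] holds,
    either family determines the other, and the laws of duals, deletions and contractions follow by
    exhibiting a pair. The delicate point of the construction is elimination. Painting at the new
    element reduces to whether a set is independent in [M], but painting at an old element is at
    hand only in [M], which knows nothing of the sign at the new element. *)

Lemma disjoint_setU1 (T : finType) (x : T) (A B : {set T}) :
  [disjoint x |: A & B] = (x \notin B) && [disjoint A & B].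
Proof.
by rewrite -disjointU1; apply: eq_disjoint => y; rewrite !inE.
Qed.

Lemma disjoint_setD (T : finType) (A B : {set T}) : [disjoint A :\: B & B].
Proof. by rewrite -setI_eq0 setDE -setIA [~: B :&: B]setIC setICr setI0. Qed.

(** * Orthogonality and painting *)

Section SignVectors.
Variable E : finType.
Implicit Types (X Y Z : svec E) (P Q C : {set svec E}) (S D : {set E}).

Lemma soppK : involutive sopp.
Proof. by case=> [[]|]. Qed.

Lemma voppK : involutive (@vopp E).
Proof. by move=> X; apply/ffunP=> x; rewrite !ffunE soppK. Qed.

Lemma vopp_Some X x b : vopp X x = Some b <-> X x = Some (~~ b).
Proof. by rewrite ffunE; case: (X x) => [[]|]; case: b. Qed.

Lemma supp_vopp X : supp (vopp X) = supp X.
Proof. by apply/setP=> x; rewrite !inE ffunE; case: (X x). Qed.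

Lemma suppP X x : reflect (exists b, X x = Some b) (x \in supp X).
Proof.
rewrite inE; case: (X x) => [b|]; constructor; first by exists b.
by case.
Qed.

Lemma Some_supp X x b : X x = Some b -> x \in supp X.
Proof. by move=> Xx; apply/suppP; exists b. Qed.

Lemma svec_eq X Y : supp X = supp Y ->
  (forall x b, X x = Some b -> Y x = Some b) -> X = Y.
Proof.
move=> eqXY XY; apply/ffunP=> x.
case Xx: (X x) => [b|]; first by rewrite (XY x b).
by move/setP/(_ x): eqXY; rewrite !inE Xx; case: (Y x).
Qed.

Lemma orthogonal_opp X Y x s : orthogonal X Y ->
  X x = Some s -> Y x = Some s ->
  exists y b, X y = Some b /\ Y y = Some (~~ b).
Proof.
move=> /orP[/eqP XY0|/andP[_ /exists_inP[y yXY Xy]]] Xx Yx; last first.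
  move: yXY Xy; rewrite !inE => /andP[]; case Xy: (X y) => [b|//] _.
  by case Yy: (Y y) => [c|//] _ /eqP[bc]; exists y, b; rewrite Xy Yy bc negbK.
have: x \in supp X :&: supp Y by rewrite !inE Xx Yx.
by rewrite XY0 inE.
Qed.

Lemma orthogonalP X Y :
  reflect ((forall x s, X x = Some s -> Y x = Some s ->
              exists y b, X y = Some b /\ Y y = Some (~~ b)) /\
           (forall x s, X x = Some s -> Y x = Some (~~ s) ->
              exists y b, X y = Some b /\ Y y = Some b))
          (orthogonal X Y).
Proof.
apply: (iffP idP) => [oXY|[opp_ex eq_ex]].
  split=> [x s|x s Xx Yx]; first exact: orthogonal_opp.
  move: oXY => /orP[/eqP XY0|/andP[/exists_inP[y yXY /eqP Xy _]]].
    have: x \in supp X :&: supp Y by rewrite !inE Xx Yx.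
    by rewrite XY0 inE.
  move: yXY; rewrite !inE -Xy => /andP[]; case Xy': (X y) => [b|//] _ _.
  by exists y, b; rewrite Xy' -Xy.
rewrite /orthogonal.
have [->|[x]] := set_0Vmem (supp X :&: supp Y); first by rewrite eqxx.
rewrite inE => /andP[/suppP[a Xx] /suppP[b Yx]]; apply/orP; right.
have [y [c [Xy Yy]]] : exists y c, X y = Some c /\ Y y = Some c.
  case: (eqVneq a b) => [ab|]; first by exists x, a; rewrite Xx Yx ab.
  by move=> ab; apply: (eq_ex x a) => //; rewrite Yx; case: (a) (b) ab => [] [].
have [z [d [Xz Yz]]] := opp_ex y c Xy Yy.
apply/andP; split; apply/exists_inP.
  by exists y; rewrite ?inE Xy Yy.
by exists z; rewrite ?inE Xz Yz //= negbK.
Qed.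

Lemma orthogonalC X Y : orthogonal X Y = orthogonal Y X.
Proof.
suff sym (U V : svec E) : orthogonal U V -> orthogonal V U.
  by apply/idP/idP; apply: sym.
move=> /orthogonalP[oUV eUV]; apply/orthogonalP; split=> x s Vx Ux.
  have [y [b [Uy Vy]]] := oUV x s Ux Vx.
  by exists y, (~~ b); rewrite negbK.
have [|y [b [Uy Vy]]] := eUV x (~~ s) Ux; first by rewrite negbK.
by exists y, b.
Qed.

Lemma orthogonal_vopp X Y : orthogonal X Y -> orthogonal X (vopp Y).
Proof.
move=> /orthogonalP[oXY eXY]; apply/orthogonalP; split=> x s Xx /vopp_Some Yx.
  by have [y [b [Xy Yy]]] := eXY x s Xx Yx; exists y, b; rewrite ffunE Yy.
rewrite negbK in Yx; have [y [b [Xy Yy]]] := oXY x s Xx Yx.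
by exists y, b; rewrite ffunE Yy /= negbK.
Qed.

Lemma orthogonal_voppl X Y : orthogonal X Y -> orthogonal (vopp X) Y.
Proof. by rewrite !(orthogonalC _ Y); apply: orthogonal_vopp. Qed.

Lemma orthogonal_agreeF X Y x s : orthogonal X Y ->
  X x = Some s -> Y x = Some s ->
  (forall y b, X y = Some b -> Y y <> Some (~~ b)) -> False.
Proof.
by move=> oXY Xx Yx XY; have [y [b [Xy /(XY y b Xy)]]] := orthogonal_opp oXY Xx Yx.
Qed.

(* [X] can only disagree with [Y1] or [Y2] at [e], where it must then agree
   with the other of the two. *)
Lemma orthogonal_elimF X Y1 Y2 e f a s : orthogonal X Y1 -> orthogonal X Y2 ->
  Y1 e = Some a -> Y2 e = Some (~~ a) -> f != e ->
  X f = Some s -> Y1 f = Some s \/ Y2 f = Some s ->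
  (forall x b, x != e -> X x = Some b ->
     Y1 x <> Some (~~ b) /\ Y2 x <> Some (~~ b)) -> False.
Proof.
wlog: Y1 Y2 a / Y1 f = Some s.
  move=> wl oX1 oX2 Y1e Y2e fe Xf [Y1f|Y2f] X12.
    by apply: (wl Y1 Y2 a) => //; left.
  apply: (wl Y2 Y1 (~~ a)) => //; first by rewrite negbK.
    by left.
  by move=> x b xe /(X12 x b xe)[].
move=> Y1f oX1 oX2 Y1e Y2e _ Xf _ X12.
have [y [b [Xy Y1y]]] := orthogonal_opp oX1 Xf Y1f.
have [ye|ye] := eqVneq y e; last by case: (X12 y b ye Xy).
have Xe : X e = Some (~~ a).
  by move: Xy Y1y; rewrite ye Y1e => -> [->]; rewrite negbK.
apply: (orthogonal_agreeF oX2 Xe Y2e) => z c Xz.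
have [ze|ze] := eqVneq z e; last by case: (X12 z c ze Xz).
by move: Xz; rewrite ze Xe Y2e => -[->] []; case: (c).
Qed.

Lemma orthogonal_card1F X Y x : orthogonal X Y -> x \in supp X -> x \in supp Y ->
  (forall y, y \in supp X -> y \in supp Y -> y = x) -> False.
Proof.
move=> /orthogonalP[oXY eXY] /suppP[a Xx] /suppP[b Yx] uniq.
have [ab|ab] := eqVneq a b.
  have [y [c [Xy Yy]]] : exists y c, X y = Some c /\ Y y = Some (~~ c).
    by apply: (oXY x a) => //; rewrite ab.
  have yx := uniq y (Some_supp Xy) (Some_supp Yy).
  move: Xy Yy; rewrite yx Xx Yx ab => -[->].
  by case: c.
have [y [c [Xy Yy]]] : exists y c, X y = Some c /\ Y y = Some c.
  by apply: (eXY x a) => //; rewrite Yx; case: (a) (b) ab => [] [].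
have yx := uniq y (Some_supp Xy) (Some_supp Yy).
by move: Xy Yy ab; rewrite yx Xx Yx => -[->] [->]; rewrite eqxx.
Qed.

(** Orthogonal vectors meeting in just two elements agree at one and are opposed at the other, so
    three of the four signs determine the last. Uniqueness of signings is read off from this. *)
Lemma orthogonal_meet2 X Y x e a b c d : orthogonal X Y ->
  (forall y, y \in supp X -> y \in supp Y -> (y == x) || (y == e)) ->
  X x = Some a -> X e = Some b -> Y x = Some c -> Y e = Some d ->
  c = ~~ (a (+) (b (+) d)).
Proof.
move=> /orthogonalP[opp_ex eq_ex] XY Xx Xe Yx Ye.
have [ca|ca] := eqVneq c a.
  have [y [k [Xy Yy]]] := opp_ex x a Xx (etrans Yx (congr1 Some ca)).
  case/orP: (XY y (Some_supp Xy) (Some_supp Yy)) => /eqP yE; move: Xy Yy.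
    by rewrite yE Xx Yx ca => -[<-] []; case: (a).
  by rewrite yE Xe Ye ca => -[->] [->]; case: (k); case: (a).
have [|y [k [Xy Yy]]] := eq_ex x a Xx.
  by rewrite Yx; congr Some; case: (c) (a) ca => [] [].
case/orP: (XY y (Some_supp Xy) (Some_supp Yy)) => /eqP yE; move: Xy Yy.
  by rewrite yE Xx Yx => -[<-] [/eqP]; rewrite (negPf ca).
by rewrite yE Xe Ye => -[->] [->]; case: (k); case: (c) (a) ca => [] [].
Qed.

Lemma pos_neg_subset X Y Z e : Z e = None ->
  (forall x b, Z x = Some b -> X x = Some b \/ Y x = Some b) ->
  pos Z \subset (pos X :|: pos Y) :\ e /\ neg Z \subset (neg X :|: neg Y) :\ e.
Proof.
move=> Ze ZXY; split; apply/subsetP=> x; rewrite !inE => /eqP Zx.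
  have xe : x != e by apply: contraPneq Zx => ->; rewrite Ze.
  by rewrite xe; case: (ZXY x true Zx) => ->; rewrite eqxx ?orbT.
have xe : x != e by apply: contraPneq Zx => ->; rewrite Ze.
by rewrite xe; case: (ZXY x false Zx) => ->; rewrite eqxx ?orbT.
Qed.

Definition opp_closed P := forall X, X \in P -> vopp X \in P.

Definition support_antichain P := forall X X', X \in P -> X' \in P ->
  supp X \subset supp X' -> supp X = supp X'.

(** [A x b] permits circuits the sign [b] at [x]; the pair [A x true], [A x false] is one of the
    four colours of Minty's painting. Where exactly one sign is permitted, it is the same for
    circuits and cocircuits, so vectors from the two alternatives are nowhere opposed: orthogonality
    makes the alternatives exclusive. *)
Definition painting_at P Q e := forall (A : E -> bool -> bool) s,
  (exists2 X, X \in P &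
     X e = Some s /\ forall x b, x != e -> X x = Some b -> A x b) \/
  (exists2 Y, Y \in Q &
     Y e = Some s /\ forall x b, x != e -> Y x = Some b -> ~~ A x (~~ b)).

(* If [f] is constrained to one sign, free it for the circuits on one side and
   for the cocircuits on the other; when neither result is already admissible,
   the two vectors agree wherever both are nonzero. *)
Lemma painting_of_two_colours P Q e :
  (forall X Y, X \in P -> Y \in Q -> orthogonal X Y) ->
  (forall S s, e \notin S ->
     (exists2 X, X \in P & X e = Some s /\ supp X \subset e |: S) \/
     (exists2 Y, Y \in Q & Y e = Some s /\ [disjoint supp Y & S])) ->
  painting_at P Q e.
Proof.
move=> oPQ two A s.
have [n] := ubnP #|[set x | (x != e) && (A x true != A x false)]|.
elim: n A => // n IHn A; rewrite ltnS => leAn.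
have [noA|[f]] :=
  set_0Vmem [set x | (x != e) && (A x true != A x false)].
  have A2 x b c : x != e -> A x b = A x c.
    move=> xe; move/setP/(_ x): noA; rewrite !inE xe /= => /negbFE/eqP Ax.
    by case: b; case: c.
  have [|[X PX [Xe XS]]|[Y QY [Ye YS]]] := two [set x | (x != e) && A x true] s.
  - by rewrite inE eqxx.
  - left; exists X => //; split=> // x b xe /Some_supp/(subsetP XS).
    by rewrite !inE (negPf xe) /= (A2 _ b true).
  - right; exists Y => //; split=> // x b xe /Some_supp Yx.
    move: (disjointFr YS Yx); rewrite inE xe /= (A2 _ (~~ b) true) //.
    by move=> ->.
rewrite inE => /andP[fe Af].
pose A1 x b := (x == f) || A x b; pose A0 x b := (x != f) && A x b.
have small B : (forall x b, x != f -> B x b = A x b) -> B f true = B f false ->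
    #|[set x | (x != e) && (B x true != B x false)]| < n.
  move=> BA Bf; apply: leq_trans leAn; apply: proper_card; apply/properP.
  split; last by exists f; rewrite inE fe ?Af // Bf eqxx.
  apply/subsetP=> x; rewrite !inE => /andP[-> /=].
  have [->|xf] := eqVneq x f; first by rewrite Bf eqxx.
  by rewrite !BA.
have [|[X1 PX1 [X1e X1A]]|[Y QY [Ye YA]]] := IHn A1; last first.
- right; exists Y => //; split=> // x b xe /(YA x b xe).
  by rewrite /A1 negb_or => /andP[].
- have [|[X PX [Xe XA]]|[Y0 QY0 [Y0e Y0A]]] := IHn A0.
  + by apply: small => [x b|]; rewrite /A0 ?eqxx //; move=> ->.
  + by left; exists X => //; split=> // x b xe /(XA x b xe)/andP[].
  case Xf: (X1 f) => [b|]; last first.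
    left; exists X1 => //; split=> // x b xe X1x.
    have /orP[/eqP xf|//] := X1A x b xe X1x.
    by rewrite xf Xf in X1x.
  have [Afb|nAfb] := boolP (A f b).
    left; exists X1 => //; split=> // x c xe X1x.
    have /orP[/eqP xf|//] := X1A x c xe X1x.
    by move: X1x; rewrite xf Xf => -[<-].
  case Yf: (Y0 f) => [c|]; last first.
    right; exists Y0 => //; split=> // x c xe Y0x.
    have := Y0A x c xe Y0x; rewrite negb_and negbK => /orP[/eqP xf|//].
    by rewrite xf Yf in Y0x.
  have [Afc|nAfc] := boolP (A f (~~ c)); last first.
    right; exists Y0 => //; split=> // x d xe Y0x.
    have := Y0A x d xe Y0x; rewrite negb_and negbK => /orP[/eqP xf|//].
    by move: Y0x; rewrite xf Yf => -[<-].
  case: (orthogonal_agreeF (oPQ _ _ PX1 QY0) X1e Y0e) => y d X1y Y0y.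
  have [ye|ye] := eqVneq y e.
    by move: X1y Y0y; rewrite ye X1e Y0e => -[->] []; case: (d).
  have [yf|yf] := eqVneq y f.
    move: X1y Y0y nAfb Afc; rewrite yf Xf Yf => -[->] [->].
    by rewrite negbK => /negP.
  have := X1A y d ye X1y; have := Y0A y (~~ d) ye Y0y.
  by rewrite negbK /A0 /A1 (negPf yf) /= => /negP.
- by apply: small => [x b|]; rewrite /A1 ?eqxx //; move=> /negPf->.
Qed.

(* The signed circuits and cocircuits of an oriented matroid, without
   reference to bases. *)
Record dual_pair P Q : Prop := DualPair {
  pair_oppl : opp_closed P;
  pair_oppr : opp_closed Q;
  pair_neq0l : forall X, X \in P -> supp X != set0;
  pair_neq0r : forall Y, Y \in Q -> supp Y != set0;
  pair_antichainl : support_antichain P;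
  pair_antichainr : support_antichain Q;
  pair_orthogonal : forall X Y, X \in P -> Y \in Q -> orthogonal X Y;
  pair_two_colours : forall S e, e \notin S ->
     (exists2 X, X \in P & e \in supp X /\ supp X \subset e |: S) \/
     (exists2 Y, Y \in Q & e \in supp Y /\ [disjoint supp Y & S])
}.

Lemma dual_pair_sym P Q : dual_pair P Q -> dual_pair Q P.
Proof.
move=> [? ? ? ? ? ? oPQ two]; split=> // [X Y QX PY|S e eS].
  by rewrite orthogonalC oPQ.
(* Exchanging the two colours exchanges the roles of circuits and cocircuits. *)
have [||[Y QY [eY YS]]] := two (~: (e |: S)) e.
- by rewrite !inE eqxx.
- move=> [X PX [eX XS]]; right; exists X => //; split=> //.
  rewrite disjoint_subset; apply/subsetP=> x xX.
  have := subsetP XS x xX; rewrite !inE.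
  by case: eqVneq => [->|_ /norP[]].
- left; exists Y => //; split=> //.
  by move: YS; rewrite disjoint_sym disjoints_subset setCS.
Qed.

Lemma opp_closed_sign P X x s : opp_closed P -> X \in P -> x \in supp X ->
  exists2 X', X' \in P & supp X' = supp X /\ X' x = Some s.
Proof.
move=> oppP PX /suppP[b Xx].
have [bs|bs] := eqVneq b s; first by exists X => //; rewrite Xx bs.
exists (vopp X); rewrite ?oppP ?supp_vopp //; split=> //.
by apply/vopp_Some; rewrite Xx; case: (b) (s) bs => [] [].
Qed.

Lemma pair_painting P Q e : dual_pair P Q -> painting_at P Q e.
Proof.
move=> PQ; apply: painting_of_two_colours; first exact: pair_orthogonal.
move=> S s eS; case: (pair_two_colours PQ eS) => -[X PX [eX XS]]; [left|right].
  have [X' PX' [sX' X'e]] := opp_closed_sign s (pair_oppl PQ) PX eX.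
  by exists X'; rewrite // sX'.
have [X' PX' [sX' X'e]] := opp_closed_sign s (pair_oppr PQ) PX eX.
by exists X'; rewrite // sX'.
Qed.

(** * Elimination and uniqueness of signings in a dual pair *)

Section Pair.
Variables P Q : {set svec E}.
Hypothesis PQ : dual_pair P Q.

(** Strong elimination, keeping [f]. The painting leaves [e] free for circuits and elsewhere bars
    them from opposing [Y1] or [Y2]; an admissible circuit through [f] is excluded by
    [orthogonal_elimF], so the painting returns a cocircuit. *)
Lemma pair_elim Y1 Y2 e f a s : Y1 \in Q -> Y2 \in Q ->
  Y1 e = Some a -> Y2 e = Some (~~ a) -> f != e ->
  Y1 f = Some s \/ Y2 f = Some s -> Y1 f <> Some (~~ s) -> Y2 f <> Some (~~ s) ->
  exists2 Z, Z \in Q & [/\ Z f = Some s, Z e = None &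
    forall x b, Z x = Some b -> Y1 x = Some b \/ Y2 x = Some b].
Proof.
move=> QY1 QY2 Y1e Y2e fe f12 Y1f Y2f.
pose A x b := (x == e) || (Y1 x != Some (~~ b)) && (Y2 x != Some (~~ b)).
have [[X PX [Xf XA]]|[Z QZ [Zf ZA]]] := pair_painting f PQ A s.
  case: (orthogonal_elimF (pair_orthogonal PQ PX QY1)
    (pair_orthogonal PQ PX QY2) Y1e Y2e fe Xf f12) => x b xe Xx.
  have [xf|xf] := eqVneq x f; first by move: Xx; rewrite xf Xf => -[<-].
  by have := XA x b xf Xx; rewrite /A (negPf xe) => /andP[/eqP ? /eqP].
exists Z => //; split=> // [|x b Zx].
  case Ze: (Z e) => [b|//]; have := ZA e b; rewrite /A eqxx /=.
  by rewrite eq_sym fe Ze => /(_ isT erefl).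
have [xf|xf] := eqVneq x f.
  by move: Zx; rewrite xf Zf => -[<-].
have := ZA x b xf Zx; rewrite negb_or negb_and !negbK => /andP[_].
by case/orP=> /eqP; [left|right].
Qed.

(** Colour [supp Y :\ f] for cocircuits: a cocircuit inside it would be properly contained in
    [supp Y]. So a circuit is found, and it contains [f] because it cannot meet [Y] in [e] alone. *)
Lemma pair_meet2 Y e f : Y \in Q -> e \in supp Y -> f \in supp Y -> e != f ->
  exists2 X, X \in P & supp X :&: supp Y = [set e; f].
Proof.
move=> QY eY fY ef.
have [|[X PX [eX XS]]|[Z QZ [eZ ZS]]] :=
  pair_two_colours PQ (S := ~: (supp Y :\ f)) (e := e).
- by rewrite in_setC negbK in_setD1 ef.
- exists X => //.
  have XY x : x \in supp X -> x \in supp Y -> (x == e) || (x == f).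
    move=> /(subsetP XS); rewrite in_setU1 inE in_setD1 negb_and negbK.
    by case/orP=> [->//|/orP[->|/negP//]]; rewrite orbT.
  have fX : f \in supp X.
    apply/idPn=> fX; apply: (orthogonal_card1F (pair_orthogonal PQ PX QY) eX eY).
    move=> y yX yY; have := XY y yX yY; case/orP=> /eqP // yf.
    by rewrite -yf yX in fX.
  apply/setP=> x; rewrite in_setI in_set2; apply/andP/orP=> [[xX xY]|].
    by apply/orP; apply: XY.
  by case=> /eqP->.
- have ZY : supp Z \subset supp Y :\ f.
    by move: ZS; rewrite disjoints_subset setCK.
  have eqZY : supp Z = supp Y.
    apply: (pair_antichainr PQ) => //.
    by apply: subset_trans ZY _; apply: subD1set.
  by have := subsetP ZY f; rewrite eqZY fY !inE eqxx => /(_ isT).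
Qed.

(** Relative to a fixed [e], the sign at any other [x] is forced by a circuit meeting the support
    only in [x] and [e]; only the sign at [e] is free. *)
Lemma pair_signing Y Y' : Y \in Q -> supp Y' = supp Y ->
  (forall X, X \in P -> orthogonal X Y') -> Y' = Y \/ Y' = vopp Y.
Proof.
move=> QY sYY' oY'.
have [e eY] := set0Pn _ (pair_neq0r PQ QY).
have [s Ye] := suppP _ _ eY.
have uniq Y0 : Y0 \in Q -> supp Y' = supp Y0 -> Y0 e = Y' e -> Y' = Y0.
  move=> QY0 sY0 Y0e; apply: svec_eq => // x b Y'x.
  have [xe|xe] := eqVneq x e; first by rewrite xe Y0e -xe.
  have eY0 : e \in supp Y0 by rewrite -sY0 sYY'.
  have xY0 : x \in supp Y0 by rewrite -sY0 (Some_supp Y'x).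
  have [X PX XY] := pair_meet2 QY0 xY0 eY0 xe.
  have oX0 := pair_orthogonal PQ PX QY0; have oX' := oY' X PX.
  have mem y : y \in supp X -> y \in supp Y0 -> (y == x) || (y == e).
    by move=> yX yY; rewrite -in_set2 -XY in_setI yX.
  have [a Xx] : exists a, X x = Some a.
    by apply/suppP; move/setP/(_ x): XY; rewrite !inE eqxx /= => /andP[].
  have [c Xe] : exists c, X e = Some c.
    by apply/suppP; move/setP/(_ e): XY; rewrite !inE eqxx orbT /= => /andP[].
  have [d Y0x] : exists d, Y0 x = Some d.
    by apply/suppP; rewrite -sY0 (Some_supp Y'x).
  have [g Y'e] : exists g, Y' e = Some g by apply/suppP; rewrite sYY'.
  rewrite Y'e in Y0e.
  have mem' y : y \in supp X -> y \in supp Y' -> (y == x) || (y == e).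
    by rewrite sY0; apply: mem.
  rewrite Y0x (orthogonal_meet2 oX0 mem Xx Xe Y0x Y0e).
  by rewrite (orthogonal_meet2 oX' mem' Xx Xe Y'x Y'e).
case Y'e: (Y' e) => [b|]; last first.
  by move: eY; rewrite -sYY' inE Y'e.
have [bs|bs] := eqVneq b s; first by left; apply: uniq; rewrite ?Ye ?Y'e ?bs.
right; apply: uniq; rewrite ?supp_vopp ?(pair_oppr PQ) //.
by rewrite ffunE Ye Y'e; case: (b) (s) bs => [] [].
Qed.

Lemma pair_incomp Y Y' : Y \in Q -> Y' \in Q -> supp Y \subset supp Y' ->
  Y = Y' \/ Y = vopp Y'.
Proof.
move=> QY QY' sub; apply: pair_signing => //.
  exact: (pair_antichainr PQ).
by move=> X PX; apply: (pair_orthogonal PQ).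
Qed.

Lemma pair_weak_elim Y1 Y2 e : Y1 \in Q -> Y2 \in Q -> Y1 <> vopp Y2 ->
  e \in pos Y1 :&: neg Y2 ->
  exists2 Z, Z \in Q & pos Z \subset (pos Y1 :|: pos Y2) :\ e /\
                       neg Z \subset (neg Y1 :|: neg Y2) :\ e.
Proof.
move=> QY1 QY2 neY; rewrite !inE => /andP[/eqP Y1e /eqP Y2e].
(* An element of [Y1] outside [Y2] carries only one sign, so strong elimination can keep it. *)
have [f fY1 fY2] : exists2 f, f \in supp Y1 & f \notin supp Y2.
  apply/subsetPn/negP=> sub; case: (pair_incomp QY1 QY2 sub) => // Y12.
  by rewrite Y12 Y2e in Y1e.
have [s Y1f] := suppP _ _ fY1.
have fe : f != e by apply: contraNneq fY2 => ->; apply: Some_supp Y2e.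
have Y2f : Y2 f = None by move: fY2; rewrite inE; case: (Y2 f).
have [|||Z QZ [_ Ze ZY]] := pair_elim (a := true) (s := s) QY1 QY2 Y1e Y2e fe.
- by left.
- by rewrite Y1f => -[]; case: (s).
- by rewrite Y2f.
exists Z => //; exact: pos_neg_subset.
Qed.

Definition om_of_pair : oriented_matroid E :=
  OrientedMatroid (pair_neq0r PQ) (pair_oppr PQ) pair_incomp pair_weak_elim.

End Pair.
End SignVectors.

(** * Bases, and the signing of cocircuits *)

Section Matroid.
Variables (E : finType) (M : oriented_matroid E).
Implicit Types (X Y Z W : svec E) (I J K B S D : {set E}).

Lemma indepP I :
  reflect (forall X, X \in circuits M -> ~~ (supp X \subset I)) (indep M I).
Proof.
apply: (iffP forall_inP) => [iI X MX|iI C /imsetP[X MX ->]]; last exact: iI.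
by apply: iI; apply: imset_f.
Qed.

Lemma indepPn I :
  reflect (exists2 X, X \in circuits M & supp X \subset I) (~~ indep M I).
Proof.
apply: (iffP idP) => [|[X MX XI]]; last by apply/negP=> /indepP/(_ X MX); rewrite XI.
by case/forall_inPn=> C /imsetP[X MX ->]; rewrite negbK; exists X.
Qed.

Lemma indepS I J : I \subset J -> indep M J -> indep M I.
Proof.
move=> IJ /indepP iJ; apply/indepP=> X MX.
by apply: contra (iJ X MX) => XI; apply: subset_trans IJ.
Qed.

Lemma indep0 : indep M set0.
Proof.
by apply/indepP=> X MX; rewrite subset0; apply: circuits_neq0 MX.
Qed.

Lemma circuit_elim X Y e s : X \in circuits M -> Y \in circuits M ->
  X e = Some s -> Y e = Some (~~ s) -> X <> vopp Y ->
  exists2 Z, Z \in circuits M & Z e = None /\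
    forall x b, Z x = Some b -> X x = Some b \/ Y x = Some b.
Proof.
wlog: X Y s / s = true.
  move=> wl; case: s => MX MY Xe Ye neq; first exact: (wl X Y true).
  have [|Z MZ [Ze ZXY]] := wl Y X true erefl MY MX Ye Xe.
    by move=> YX; apply: neq; rewrite YX voppK.
  by exists Z => //; split=> // x b /ZXY; tauto.
move=> -> MX MY Xe Ye neq.
have [|Z MZ [/subsetP pZ /subsetP nZ]] := circuits_elim MX MY neq (e := e).
  by rewrite !inE Xe Ye.
exists Z => //; split=> [|x [] Zx].
- case Ze: (Z e) => [[]|//].
    by have := pZ e; rewrite !inE Ze !eqxx /= => /(_ isT).
  by have := nZ e; rewrite !inE Ze !eqxx /= => /(_ isT).
- have := pZ x; rewrite !inE Zx eqxx => /(_ isT)/andP[_].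
  by case/orP=> /eqP; [left|right].
- have := nZ x; rewrite !inE Zx eqxx => /(_ isT)/andP[_].
  by case/orP=> /eqP; [left|right].
Qed.

Lemma circuit_sign X x s : X \in circuits M -> x \in supp X ->
  exists2 X', X' \in circuits M & supp X' = supp X /\ X' x = Some s.
Proof. by apply: opp_closed_sign => ?; apply: circuits_opp. Qed.

Lemma circuit_mem I e X : indep M I -> X \in circuits M ->
  supp X \subset e |: I -> e \in supp X.
Proof.
move=> /indepP/(_ X) iI MX XI; apply: contraR (iI MX) => eX.
apply/subsetP=> x xX; have := subsetP XI x xX; rewrite in_setU1.
by case/orP=> // /eqP xe; rewrite -xe xX in eX.
Qed.

Lemma fundamental_circuit_uniq I e X Y : indep M I ->
  X \in circuits M -> Y \in circuits M ->
  supp X \subset e |: I -> supp Y \subset e |: I -> supp X = supp Y.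
Proof.
move=> iI MX MY XI YI.
have [X' MX' [sX X'e]] := circuit_sign true MX (circuit_mem iI MX XI).
have [Y' MY' [sY Y'e]] := circuit_sign false MY (circuit_mem iI MY YI).
rewrite -sX -sY in XI YI *.
have [->|/eqP neq] := eqVneq X' (vopp Y'); first by rewrite supp_vopp.
have [Z MZ [Ze ZXY]] := circuit_elim MX' MY' X'e Y'e neq.
have : supp Z \subset e |: I.
  apply/subsetP=> x /suppP[b /ZXY[] /Some_supp].
    exact: (subsetP XI).
  exact: (subsetP YI).
by move=> /(circuit_mem iI MZ)/suppP[b]; rewrite Ze.
Qed.

Lemma indep_exchange I e X f : indep M I -> X \in circuits M ->
  supp X \subset e |: I -> f \in supp X -> indep M ((e |: I) :\ f).
Proof.
move=> iI MX XI fX; apply/indepP=> Y MY; apply/negP=> YI.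
have YI' := subset_trans YI (subD1set _ _).
have := subsetP YI f; rewrite (fundamental_circuit_uniq iI MY MX YI' XI).
by move=> /(_ fX); rewrite !inE eqxx.
Qed.

(** Induction on [#|I :\: J|]: an [e] of [I] outside [J] is added to [J], or exchanged for an
    element, outside [I], of the circuit it closes. Since [e] lies in [I], the element found for the
    new set already belonged to [J]. *)
Lemma augment I J : indep M I -> indep M J -> #|I| < #|J| ->
  exists2 e, e \in J :\: I & indep M (e |: I).
Proof.
move=> iI; have [n] := ubnP #|I :\: J|.
elim: n J => // n IHn J; rewrite ltnS => leIJ iJ ltIJ.
have [IJ|/subsetPn[e eI eJ]] := boolP (I \subset J).
  have /properP[_ [e eJ eI]] : I \proper J by rewrite properEcard IJ.
  exists e; first by rewrite inE eI.
  by apply: indepS iJ; rewrite subUset sub1set eJ.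
have small K : e \in K -> (forall x, x \in I -> x \in J -> x \in K) ->
    #|I :\: K| < n.
  move=> eK IJK; apply: leq_trans leIJ; apply: proper_card; apply/properP.
  split; last by exists e; rewrite !inE ?eK // eJ.
  apply/subsetP=> x; rewrite !inE => /andP[xK xI]; rewrite xI andbT.
  by apply: contra xK; apply: IJK.
have [ieJ|/indepPn[X MX XJ]] := boolP (indep M (e |: J)).
  have [|||f] := IHn (e |: J) => //.
  - by apply: small => [|x _ xJ]; rewrite !inE ?eqxx // xJ orbT.
  - by rewrite cardsU1 eJ ltnW.
  rewrite !inE => /andP[fI /orP[/eqP fe|fJ] ifI].
    by rewrite fe eI in fI.
  by exists f; rewrite // inE fI.
have /subsetPn[f fX fI] := indepP _ iI X MX.
have fe : f != e by apply: contraNneq fI => ->.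
have fJ : f \in J by have := subsetP XJ f fX; rewrite in_setU1 (negPf fe).
have [|||g] := IHn ((e |: J) :\ f) => //.
- apply: small => [|x xI xJ]; first by rewrite !inE eq_sym fe eqxx.
  by rewrite !inE xJ orbT andbT; apply: contraNneq fI => <-.
- exact: indep_exchange XJ fX.
- have := cardsD1 f (e |: J); rewrite cardsU1 eJ in_setU1 fJ orbT.
  by move/addnI=> <-.
rewrite !inE => /and3P[gI gf /orP[/eqP ge|gJ]] igI.
  by rewrite ge eI in gI.
by exists g; rewrite // inE gI.
Qed.

Lemma basis_exists I : indep M I -> exists2 B, basis M B & I \subset B.
Proof. by case/maxset_exists=> B; exists B. Qed.

Lemma basis_indep B : basis M B -> indep M B.
Proof. by case/maxsetP. Qed.

Lemma basis_max B I : basis M B -> indep M I -> B \subset I -> I = B.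
Proof. by case/maxsetP=> _; apply. Qed.

Lemma indep_leq_basis I B : indep M I -> basis M B -> #|I| <= #|B|.
Proof.
move=> iI bB; rewrite leqNgt; apply/negP=> lt.
have [e eI ieB] := augment (basis_indep bB) iI lt.
have := basis_max bB ieB (subsetU1 _ _).
by move/setP/(_ e); rewrite !inE eqxx /=; move: eI; rewrite inE => /andP[/negPf->].
Qed.

Lemma rank_basis B : basis M B -> rank M = #|B|.
Proof.
move=> bB; apply/eqP; rewrite eqn_leq; apply/andP; split.
  by apply/bigmax_leqP=> I /andP[iI _]; apply: indep_leq_basis.
by apply: (leq_bigmax_cond B); rewrite basis_indep ?subsetT.
Qed.

Lemma indep_leq_rank I : indep M I -> #|I| <= rank M.
Proof.
move=> iI; have [B bB _] := basis_exists indep0.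
by rewrite (rank_basis bB) indep_leq_basis.
Qed.

Lemma indep_basis I : indep M I -> #|I| = rank M -> basis M I.
Proof.
move=> iI cI; have [B bB IB] := basis_exists iI.
suff -> : I = B by [].
by apply/eqP; rewrite eqEcard IB cI (rank_basis bB) /=.
Qed.

Lemma spanningP S : reflect (exists2 B, basis M B & B \subset S) (spanning M S).
Proof.
apply: (iffP eqP) => [rS|[B bB BS]]; last first.
  apply/eqP; rewrite eqn_leq; apply/andP; split.
    by apply/bigmax_leqP=> I /andP[iI _]; apply: indep_leq_rank.
  by rewrite (rank_basis bB); apply: (leq_bigmax_cond B); rewrite basis_indep.
have [I /andP[iI IS] rI] :
    {I | indep M I && (I \subset S) & rank_of M S = #|I|}.
  apply: eq_bigmax_cond; apply/card_gt0P; exists set0.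
  by rewrite unfold_in /= indep0 sub0set.
by exists I => //; apply: indep_basis => //; rewrite -rI.
Qed.

(* The closed set complementary to [D] is spanned by [J].  Relative signs on [D]
   are read off the circuits in [f |: (e0 |: I)], for [I] a basis of the
   complement of [D]; a basis exchange inside that complement preserves them. *)
Section Hyperplane.
Variables (J : {set E}) (e0 : E).
Hypotheses (e0J : e0 \notin J) (bJ : basis M (e0 |: J)).

Let D := [set f | (f \notin J) && indep M (f |: J)].

Let iJ : indep M J.
Proof. exact: indepS (subsetU1 _ _) (basis_indep bJ). Qed.

Let e0D : e0 \in D.
Proof. by rewrite inE e0J basis_indep. Qed.

(** The bases of the hyperplane complementary to [D]. *)
Let hb I := [&& indep M I, #|I| == #|J| & [disjoint I & D]].

Let DJ f : f \in D -> f \notin J.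
Proof. by rewrite inE => /andP[]. Qed.

Let outD I : indep M I -> #|J| < #|I| -> exists2 f, f \in I & f \in D.
Proof.
move=> iI /(augment iJ iI)[f]; rewrite inE => /andP[fJ fI] ifJ.
by exists f; rewrite // inE fJ.
Qed.

Let hbJ : hb J.
Proof.
rewrite /hb iJ eqxx disjoint_sym disjoint_subset; apply/subsetP=> f.
exact: DJ.
Qed.

Let hb_extend K : indep M K -> [disjoint K & D] -> exists2 I, hb I & K \subset I.
Proof.
move=> iK KD.
have [|I /maxsetP[/andP[iI ID] maxI] KI] :=
  @maxset_exists _ [pred I | indep M I && [disjoint I & D]] K.
  by rewrite /= iK.
exists I => //; apply/and3P; split=> //; rewrite eqn_leq; apply/andP; split.
  rewrite leqNgt; apply/negP=> /(outD iI)[f fI fD].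
  by rewrite (disjointFr ID fI) in fD.
rewrite leqNgt; apply/negP=> /(augment iI iJ)[f]; rewrite inE => /andP[fI fJ] ifI.
have := maxI (f |: I); rewrite /= ifI subsetU1 disjoint_setU1 => H.
have fI' : f |: I = I.
  apply: H => //; rewrite ID andbT; apply: contraL fJ; exact: DJ.
by move: fI; rewrite -fI' setU11.
Qed.

Let hb_spans I f : hb I -> f \in D -> indep M (f |: I).
Proof.
move=> /and3P[iI /eqP cI ID] fD; apply/idPn=> nfI.
have [|||g] := @augment I (f |: J) => //.
- by move: fD; rewrite inE => /andP[].
- by rewrite cardsU1 DJ // cI.
rewrite !inE => /andP[gI /orP[/eqP gf|gJ]] igI; first by rewrite -gf igI in nfI.
have [|h] := outD igI; first by rewrite cardsU1 gI cI.
rewrite in_setU1 => /orP[/eqP->|hI] hD; first by rewrite (negPf (DJ hD)) in gJ.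
by rewrite (disjointFr ID hI) in hD.
Qed.

Let hb_closed I g : hb I -> g \notin I -> g \notin D -> ~~ indep M (g |: I).
Proof.
move=> /and3P[iI /eqP cI ID] gI gD; apply/negP=> igI.
have [|h] := outD igI; first by rewrite cardsU1 gI cI.
rewrite in_setU1 => /orP[/eqP->|hI] hD; first by rewrite hD in gD.
by rewrite (disjointFr ID hI) in hD.
Qed.

Let circuitD_indep X f : X \in circuits M -> f \in supp X -> f \in D ->
  indep M (supp X :\: D).
Proof.
move=> MX fX fD; apply/indepP=> Z MZ; apply/negP=> ZX.
have [] := circuits_incomp MZ MX (subset_trans ZX (subsetDl _ _)) => ZE.
  by have := subsetP ZX f; rewrite ZE fX in_setD fD => /(_ isT).
by have := subsetP ZX f; rewrite ZE supp_vopp fX in_setD fD => /(_ isT).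
Qed.

(** Otherwise [supp X :\: D] extends to a basis [I] of the hyperplane, and the independent set
    [f |: I] contains [supp X]. *)
Let circuit_meets2 X f : X \in circuits M -> f \in supp X -> f \in D ->
  exists2 y, y \in supp X & (y \in D) && (y != f).
Proof.
move=> MX fX fD.
have [y yP|no] := pickP [pred y in supp X | (y \in D) && (y != f)].
  by exists y; case/andP: yP.
have [||I hI KI] := @hb_extend (supp X :\: D).
- exact: circuitD_indep fX fD.
- exact: disjoint_setD.
have /indepP/(_ X MX)/negP[] := hb_spans hI fD.
apply/subsetP=> x xX; rewrite in_setU1.
have := no x; rewrite /= xX; have [->//|xf] := eqVneq x f.
by rewrite andbT => /= xD; rewrite (subsetP KI) // in_setD xX xD.
Qed.

Let circuit_misses X f : X \in circuits M ->
  (forall x, x \in supp X -> x \in D -> x = f) -> [disjoint supp X & D].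
Proof.
move=> MX Xf; rewrite disjoint_subset; apply/subsetP=> x xX; apply/negP=> xD.
have [y yX /andP[yD]] := circuit_meets2 MX xX xD.
by rewrite (Xf x xX xD) (Xf y yX yD) eqxx.
Qed.

(** The set has one element more than the rank, hence contains a circuit; this uses both [f] and
    [e0] because [e0 |: I] and [f |: I] are independent. *)
Let span2 I f : hb I -> f \in D -> f != e0 ->
  exists2 W, W \in circuits M &
    [/\ supp W \subset f |: (e0 |: I), W e0 = Some true & f \in supp W].
Proof.
move=> hI fD fe.
have ID : [disjoint I & D] by case/and3P: hI.
have cI : #|I| = #|J| by case/and3P: hI => _ /eqP.
have [|W0 MW0 W0I] := @indepPn (f |: (e0 |: I)) _.
  apply/negP=> /indep_leq_rank; rewrite (rank_basis bJ) !cardsU1 e0J cI.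
  by rewrite !inE negb_or fe (disjointFl ID fD) (disjointFl ID e0D) ltnn.
have fW : f \in supp W0 by apply: circuit_mem W0I => //; apply: hb_spans.
have eW : e0 \in supp W0.
  by apply: (@circuit_mem (f |: I)); rewrite ?hb_spans // setUCA.
have [W MW [sW We]] := circuit_sign true MW0 eW.
by exists W; rewrite ?sW.
Qed.

(** The circuit [X] meets [D] at most in [e0] and [f] and agrees with the sign + given to [e0];
    orthogonality then forces the opposite of [X f] at [f]. *)
Let sgn f : sign :=
  if f == e0 then Some true else
  if f \notin D then None else
  if [pick X in circuits M | (supp X \subset f |: (e0 |: J)) && (X e0 == Some true)]
    is Some X then sopp (X f) else None.

Let Y : svec E := finfun sgn.

Let compatible I := forall f X, f \in D -> f != e0 -> X \in circuits M ->
  supp X \subset f |: (e0 |: I) -> X e0 = Some true -> X f = sopp (Y f).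

Let compatibleJ : compatible J.
Proof.
move=> f X fD fe MX XJ Xe; rewrite ffunE /sgn (negPf fe) fD /=.
case: pickP => [X'|/(_ X)]; last by rewrite MX XJ Xe eqxx.
case/and3P=> MX' X'J /eqP X'e; rewrite soppK.
have sXX' := fundamental_circuit_uniq (basis_indep bJ) MX MX' XJ X'J.
have [|->//|XX'] := circuits_incomp MX MX'; first by rewrite sXX'.
by move: Xe; rewrite XX' ffunE X'e.
Qed.

Let suppY : supp Y = D.
Proof.
apply/setP=> f; apply/idP/idP.
  move=> /suppP[b]; rewrite ffunE /sgn; have [->//|fe] := eqVneq f e0.
  by case: (f \in D).
move=> fD; have [->|fe] := eqVneq f e0; first by rewrite inE ffunE /sgn eqxx.
have [W MW [WJ We /suppP[b Wf]]] := span2 hbJ fD fe.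
have := compatibleJ fD fe MW WJ We; rewrite Wf inE; by case: (Y f).
Qed.

Let Ye0 : Y e0 = Some true.
Proof. by rewrite ffunE /sgn eqxx. Qed.

(** Let [W] and [X] be the circuits for the two bases, both + at [e0]. If they differed at [f],
    eliminating [f] from [W] and [X], and [e0] from [W] and [vopp X], would give circuits meeting
    [D] at most once, hence not at all. Both then lie in [g |: I] and contain [g] and [h], so they
    are equal or opposite; yet they have the same sign at [h], inherited from [W], and opposite
    signs at [g], inherited from [X] and [vopp X]. *)
Let compatible_exchange I g h : hb I -> compatible I -> g \notin I -> h \in I ->
  hb (g |: (I :\ h)) -> compatible (g |: (I :\ h)).
Proof.
move=> hI cI gI hIn; set I' := g |: (I :\ h) => hI' f X fD fe MX XI' Xe.
have iI : indep M I by case/and3P: hI.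
have iI' : indep M I' by case/and3P: hI'.
have ID : [disjoint I & D] by case/and3P: hI.
have I'D : [disjoint I' & D] by case/and3P: hI'.
have gD : g \notin D by rewrite (disjointFr I'D) // !inE eqxx.
have hD : h \notin D by rewrite (disjointFr ID).
have gh : g != h by apply: contraNneq gI => ->.
have [W MW [WI We fW]] := span2 hI fD fe.
rewrite -(cI f W fD fe MW WI We).
have [b Wf] := suppP _ _ fW.
have [c Xf] : exists c, X f = Some c.
  by apply/suppP/(circuit_mem _ MX XI'); apply: hb_spans.
apply/eqP/idPn; rewrite Wf Xf => /eqP cb.
have {}cb : c = ~~ b by case: (c) (b) cb => [] [].
have Wg : W g = None.
  case Wg: (W g) => [a|//]; have := subsetP WI g (Some_supp Wg).
  rewrite !in_setU1 (negPf gI) orbF => /orP[]/eqP gE; move: gD.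
    by rewrite gE fD.
  by rewrite gE e0D.
have Xh : X h = None.
  case Xh: (X h) => [a|//]; have := subsetP XI' h (Some_supp Xh).
  rewrite !in_setU1 in_setD1 eqxx orbF eq_sym [h == e0]eq_sym => /or3P[]/eqP hE.
  - by move: hD; rewrite -hE fD.
  - by move: hD; rewrite -hE e0D.
  - by move: gh; rewrite hE eqxx.
have sub x : x \in supp W \/ x \in supp X -> x \in f |: (e0 |: (g |: I)).
  case=> [/(subsetP WI)|/(subsetP XI')]; rewrite !inE.
    by case/or3P=> ->; rewrite /= ?orbT.
  by case/or4P=> [|||/andP[_]] ->; rewrite /= ?orbT.
have inner Z : Z \in circuits M ->
    (forall x, x \in supp Z -> x \in supp W \/ x \in supp X) ->
    Z e0 = None \/ Z f = None -> [/\ Z e0 = None, supp Z \subset g |: I,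
      g \in supp Z & h \in supp Z].
  move=> MZ ZWX Zef.
  have ZD : [disjoint supp Z & D].
    have gI_D x : x \in g |: I -> x \notin D.
      rewrite in_setU1 => /orP[/eqP->//|xI]; by rewrite (disjointFr ID).
    case: Zef => Z0; [apply: (@circuit_misses Z f)|apply: (@circuit_misses Z e0)] => //.
      move=> x xZ xD; have := sub x (ZWX x xZ); rewrite !(in_setU1 x).
      case/or3P=> [/eqP//|/eqP xe|]; first by rewrite xe inE Z0 in xZ.
      by rewrite -in_setU1 => /gI_D; rewrite xD.
    move=> x xZ xD; have := sub x (ZWX x xZ); rewrite !(in_setU1 x).
    case/or3P=> [/eqP xf|/eqP//|]; first by rewrite xf inE Z0 in xZ.
    by rewrite -in_setU1 => /gI_D; rewrite xD.
  have ZI : supp Z \subset g |: I.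
    apply/subsetP=> x xZ; have := sub x (ZWX x xZ); rewrite in_setU1.
    case/orP=> [/eqP xf|]; first by rewrite xf (disjointFl ZD fD) in xZ.
    rewrite in_setU1 => /orP[/eqP xe|//].
    by rewrite xe (disjointFl ZD e0D) in xZ.
  split=> //.
  - case Z0: (Z e0) => [a|//].
    by have := disjointFr ZD (Some_supp Z0); rewrite e0D.
  - exact: circuit_mem ZI.
  - apply/idPn=> hZ; have /indepP/(_ Z MZ)/negP[] := iI'.
    apply/subsetP=> x xZ; have := subsetP ZI x xZ; rewrite !inE.
    case/orP=> [->//|xI]; rewrite xI andbT orbC.
    by rewrite (contraNneq _ hZ) // => <-.
have nWX : W <> vopp X by move=> WX; move: We; rewrite WX ffunE Xe.
have nWX' : W <> vopp (vopp X).
  by rewrite voppK => WX; move: Wf; rewrite WX Xf cb => -[]; case: (b).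
rewrite cb in Xf; have Xe' : vopp X e0 = Some (~~ true) by rewrite ffunE Xe.
have [Z MZ [Zf ZWX]] := circuit_elim MW MX Wf Xf nWX.
have [Z2 MZ2 [Z2e Z2WX]] := circuit_elim MW (circuits_opp MX) We Xe' nWX'.
have [||_ ZI gZ hZ] := inner Z MZ.
- by move=> x /suppP[a /ZWX[]/Some_supp]; [left|right].
- by right.
have [||_ Z2I gZ2 hZ2] := inner Z2 MZ2.
- move=> x /suppP[a /Z2WX[]/Some_supp]; first by left.
  by rewrite supp_vopp; right.
- by left.
have [a Zg] := suppP _ _ gZ; have [d Zh] := suppP _ _ hZ.
have [a2 Z2g] := suppP _ _ gZ2; have [d2 Z2h] := suppP _ _ hZ2.
have Xg : X g = Some a by case: (ZWX g a Zg) => //; rewrite Wg.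
have Wh : W h = Some d by case: (ZWX h d Zh) => //; rewrite Xh.
have dd2 : d2 = d.
  by case: (Z2WX h d2 Z2h); rewrite ?Wh ?ffunE ?Xh // => -[].
have aa2 : a2 = ~~ a.
  by case: (Z2WX g a2 Z2g); rewrite ?Wg ?ffunE ?Xg // => -[].
have sZ := fundamental_circuit_uniq iI MZ2 MZ Z2I ZI.
have [|ZZ|ZZ] := circuits_incomp MZ2 MZ; first by rewrite sZ.
  by move: Z2g; rewrite ZZ Zg aa2 => -[]; case: (a).
by move: Z2h; rewrite ZZ ffunE Zh dd2 => -[]; case: (d).
Qed.

(** Any two bases of the hyperplane are joined by exchanges. All of them are needed because
    orthogonality to a circuit is tested with a basis containing the part of that circuit outside
    [D]. *)
Let compatible_all I : hb I -> compatible I.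
Proof.
suff all_I n K : hb K -> compatible K -> #|I :\: K| < n -> hb I -> compatible I.
  by move=> hI; exact: (all_I _ J hbJ compatibleJ (leqnn _) hI).
elim: n K => // n IHn K hK cK; rewrite ltnS => leIK hI.
have [IK|/subsetPn[g gI gK]] := boolP (I \subset K).
  suff -> : I = K by [].
  apply/eqP; rewrite eqEcard IK.
  have /and3P[_ /eqP-> _] := hK; have /and3P[_ /eqP-> _] := hI.
  exact: leqnn.
have [iI /eqP ccI ID] := and3P hI; have [iK /eqP ccK KD] := and3P hK.
have gD : g \notin D by rewrite (disjointFr ID).
have /indepPn[X MX XK] := hb_closed hK gK gD.
have /subsetPn[h hX hI'] := indepP _ iI X MX.
have gh : g != h by apply: contraNneq hI' => <-.
have hK' : h \in K.
  by have := subsetP XK h hX; rewrite in_setU1 eq_sym (negPf gh).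
have eqK : (g |: K) :\ h = g |: (K :\ h).
  by apply/setP=> x; rewrite !inE; have [->|] := eqVneq x g; rewrite ?gh.
have hK2 : hb (g |: (K :\ h)).
  apply/and3P; split.
  - by rewrite -eqK; apply: indep_exchange XK hX.
  - by rewrite cardsU1 !inE (negPf gK) andbF -ccK (cardsD1 h K) hK'.
  - rewrite disjoint_setU1 gD; apply: disjointWl KD; exact: subD1set.
apply: (IHn (g |: (K :\ h))) => //; first exact: compatible_exchange.
apply: leq_trans leIK; apply: proper_card; apply/properP; split.
  apply/subsetP=> x; rewrite !inE => /andP[] /norP[xg].
  rewrite negb_and negbK => /orP[/eqP->|->//]; by rewrite (negPf hI').
by exists g; rewrite !inE ?eqxx // gK gI.
Qed.

(** Eliminating an element [f] of [D] against the circuit on [f], [e0] and [I] that is + at [e0]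
    preserves agreement with [Y] and removes [f]. By induction the result misses [D], and so is a
    circuit inside the independent set [I]: no such [f] exists, and [X] meets [D] at most in
    [e0]. *)
Let agree_misses I X : hb I -> X \in circuits M -> supp X \subset I :|: D ->
  (forall x b, x \in D -> X x = Some b -> Y x = Some b) -> [disjoint supp X & D].
Proof.
move=> hI; have [n] := ubnP #|(supp X :&: D) :\ e0|.
elim: n X => // n IHn X; rewrite ltnS => leX MX XI XY.
have cI := compatible_all hI; have iI : indep M I by case/and3P: hI.
have ID : [disjoint I & D] by case/and3P: hI.
have [/eqP X0|[f]] := set_0Vmem ((supp X :&: D) :\ e0).
  apply: (@circuit_misses X e0) => // x xX xD; apply/eqP/idPn=> xe.
  by move/eqP/setP/(_ x): X0; rewrite in_set0 in_setD1 xe in_setI xX xD.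
rewrite in_setD1 in_setI => /and3P[fe fX fD].
have [W MW [WI We fW]] := span2 hI fD fe.
have [b Xf] := suppP _ _ fX; have Yf := XY f b fD Xf.
have Wf : W f = Some (~~ b) by rewrite (cI f W fD fe MW WI We) Yf.
have [|Z MZ [Zf ZXW]] := circuit_elim MX MW Xf Wf _.
  move=> XW; have Xe : X e0 = Some false by rewrite XW ffunE We.
  by have := XY e0 false e0D Xe; rewrite Ye0.
have WD x c : W x = Some c -> x \in D -> x = e0 \/ x = f.
  move=> /Some_supp/(subsetP WI); rewrite !(in_setU1 x).
  by case/or3P=> [/eqP|/eqP|/(disjointFr ID)->]; [right|left|].
have ZD : [disjoint supp Z & D].
  apply: IHn => //.
  - apply: leq_trans leX; apply: proper_card; apply/properP; split; last first.
      by exists f; rewrite !inE ?fe ?Xf ?Zf ?andbF //; move: fD; rewrite inE.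
    apply/subsetP=> x; rewrite !in_setD1 !in_setI => /and3P[xe /suppP[c Zx] xD].
    rewrite xe xD andbT /=; case: (ZXW x c Zx) => [/Some_supp//|Wx].
    case: (WD x c Wx xD) => xE; first by rewrite xE eqxx in xe.
    by rewrite xE Zf in Zx.
  - apply/subsetP=> x /suppP[c /ZXW[]/Some_supp]; first exact: (subsetP XI).
    move=> /(subsetP WI); rewrite !in_setU1 in_setU.
    by case/or3P=> [/eqP->|/eqP->|->//]; rewrite ?fD ?e0D orbT.
  - move=> x c xD Zx; case: (ZXW x c Zx) => [|Wx]; first exact: XY.
    case: (WD x c Wx xD) => xE; last by rewrite xE Zf in Zx.
    by move: Wx; rewrite xE We Ye0.
have /indepP/(_ Z MZ)/negP[] := iI.
apply/subsetP=> x xZ; have /suppP[c /ZXW[]/Some_supp] := xZ.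
  by move/(subsetP XI); rewrite in_setU (disjointFr ZD xZ) orbF.
move=> /(subsetP WI); rewrite !in_setU1.
by case/or3P=> [/eqP xE|/eqP xE|//]; move: xZ; rewrite xE (disjointFl ZD).
Qed.

Let orthogonalY X : X \in circuits M -> orthogonal X Y.
Proof.
have opp_ex X' x s : X' \in circuits M -> X' x = Some s -> Y x = Some s ->
    exists y b, X' y = Some b /\ Y y = Some (~~ b).
  move=> MX Xx Yx.
  have xD : x \in D by rewrite -suppY (Some_supp Yx).
  have xX := Some_supp Xx.
  have [||I hI KI] := @hb_extend (supp X' :\: D).
  - exact: circuitD_indep xX xD.
  - exact: disjoint_setD.
  have [y /andP[/suppP[b Xy] Yy]|no] := pickP [pred y in supp X' | Y y == sopp (X' y)].
    by exists y, b; rewrite (eqP Yy) Xy.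
  suff H : [disjoint supp X' & D] by rewrite (disjointFr H xX) in xD.
  apply: (@agree_misses I X') => //.
    apply/subsetP=> y yX; rewrite in_setU orbC.
    have [//|yD] := boolP (y \in D); by rewrite (subsetP KI) // in_setD yD.
  move=> y b yD Xy; have := no y; rewrite /= (Some_supp Xy) Xy /=.
  move: yD; rewrite -suppY => /suppP[c ->].
  by case: (b) (c) => [] [].
move=> MX; apply/orthogonalP; split=> x s; first exact: opp_ex.
move=> Xx Yx.
have [||y [b [/vopp_Some Xy Yy]]] := opp_ex _ x (~~ s) (circuits_opp MX).
- by rewrite ffunE Xx.
- by [].
- by exists y, (~~ b).
Qed.

Let ucocircuitD : D \in ucocircuits M.
Proof.
rewrite inE; apply/minsetP; split=> [|S /forall_inP hitS SD].
  apply/forall_inP=> B bB; apply/subsetPn.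
  have [|f fB fD] := outD (basis_indep bB).
    by rewrite -(rank_basis bB) (rank_basis bJ) cardsU1 e0J.
  by exists f; rewrite // inE fB.
apply/eqP; rewrite eqEsubset SD; apply/subsetP=> f fD; apply/idPn=> fS.
have bf : basis M (f |: J).
  apply: indep_basis; first by move: fD; rewrite inE => /andP[].
  by rewrite (rank_basis bJ) !cardsU1 e0J DJ.
have /negP[] := hitS _ bf; apply/subsetP=> x xS; rewrite !inE negb_or.
rewrite DJ ?(subsetP SD) // andbT; by apply: contraNneq fS => <-.
Qed.

Lemma hyperplane_cocircuit : exists2 Y, Y \in cocircuits M &
  e0 \in supp Y /\ [disjoint supp Y & [set f | (f \in J) || ~~ indep M (f |: J)]].
Proof.
exists Y; last first.
  rewrite suppY; split=> //; rewrite disjoint_subset.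
  by apply/subsetP=> f; rewrite !inE => /andP[/negPf-> ->].
by rewrite inE suppY ucocircuitD; apply/forall_inP=> X /orthogonalY.
Qed.

End Hyperplane.

Lemma ucocircuit_basis D B : D \in ucocircuits M -> basis M B ->
  exists2 x, x \in D & x \in B.
Proof.
rewrite inE => /minsetP[/forall_inP hD _] /hD/subsetPn[x xD].
by rewrite inE negbK; exists x.
Qed.

Lemma oriented_matroid_pair : dual_pair (circuits M) (cocircuits M).
Proof.
split=> [X|Y|X|Y|X X'|Y Y'|X Y|S e eS].
- exact: circuits_opp.
- rewrite !inE supp_vopp => /andP[-> /forall_inP oY]; apply/forall_inP=> X MX.
  exact/orthogonal_vopp/oY.
- exact: circuits_neq0.
- rewrite inE => /andP[hY _]; apply/set0Pn.
  have [B bB _] := basis_exists indep0.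
  by have [x xY _] := ucocircuit_basis hY bB; exists x.
- move=> MX MX' /(circuits_incomp MX MX')[->//|->]; exact: supp_vopp.
- rewrite !inE => /andP[/minsetP[hY _] _] /andP[/minsetP[_ minY'] _] sub.
  exact: minY'.
- by move=> MX; rewrite inE => /andP[_ /forall_inP]; apply.
- have [|I /maxsetP[/andP[iI IS] maxI] _] :=
    @maxset_exists _ [pred I | indep M I && (I \subset S)] set0.
    by rewrite /= indep0 sub0set.
  have eI : e \notin I by apply: contra eS; apply: (subsetP IS).
  have [ieI|/indepPn[X MX XI]] := boolP (indep M (e |: I)); last first.
    left; exists X => //; split; first exact: circuit_mem XI.
    by apply: subset_trans XI _; apply: setUS.
  (* By maximality of [I], all of [S] lies in the hyperplane spanned by [B :\ e], so the cocircuit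
     complementary to it avoids [S]. *)
  right; have [B bB eIB] := basis_exists ieI.
  have eB : e \in B by rewrite (subsetP eIB) ?setU11.
  have [||Y MY [eY YB]] := @hyperplane_cocircuit (B :\ e) e.
  + by rewrite !inE eqxx.
  + by rewrite setD1K.
  exists Y => //; split=> //; apply: disjointWr YB.
  apply/subsetP=> x xS; rewrite !inE.
  have [xe|xe] := eqVneq x e; first by rewrite -xe xS in eS.
  have [//|xB] := boolP (x \in B); apply/negP=> ixB.
  have IB : I \subset B :\ e.
    rewrite subsetD1 eI andbT; apply: subset_trans eIB; exact: subsetU1.
  have := maxI (x |: I); rewrite /= subsetU1 subUset sub1set xS IS.
  rewrite (indepS _ ixB) ?setUS // => /(_ isT isT)/setP/(_ x).
  rewrite setU11 => /esym xI.
  by have := subsetP IB x xI; rewrite !inE (negPf xB) andbF.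
Qed.

End Matroid.

(** * Duality *)

(** Two-colouring yields, below each vector of one family, a vector of the other through the same
    element. Going there and back, the antichain property makes the supports equal, and
    [pair_signing] settles the signs. *)
Lemma pair_uniqr_sub (E : finType) (P Q Q' : {set svec E}) :
  dual_pair P Q -> dual_pair P Q' -> Q \subset Q'.
Proof.
move=> PQ PQ'.
have below (R R' : {set svec E}) Y e : dual_pair P R -> dual_pair P R' ->
    Y \in R -> e \in supp Y ->
    exists2 Y', Y' \in R' & supp Y' \subset supp Y /\ e \in supp Y'.
  move=> PR PR' RY eY.
  have [|[X PX [eX XS]]|[Y' RY' [eY' Y'S]]] :=
    pair_two_colours PR' (S := ~: supp Y) (e := e).
  - by rewrite in_setC eY.
  - case: (orthogonal_card1F (pair_orthogonal PR PX RY) eX eY) => y yX yY.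
    by have := subsetP XS y yX; rewrite in_setU1 in_setC yY orbF => /eqP.
  - exists Y' => //; split=> //.
    by move: Y'S; rewrite disjoints_subset setCK.
apply/subsetP=> Y QY; have [e eY] := set0Pn _ (pair_neq0r PQ QY).
have [Y' QY' [Y'Y eY']] := below _ _ _ _ PQ PQ' QY eY.
have [Y2 QY2 [Y2Y' eY2]] := below _ _ _ _ PQ' PQ QY' eY'.
have sYY' : supp Y = supp Y'.
  apply/eqP; rewrite eqEsubset Y'Y andbT.
  by rewrite -(pair_antichainr PQ QY2 QY (subset_trans Y2Y' Y'Y)).
have [X PX||] := pair_signing PQ' QY' sYY'; first exact: pair_orthogonal PX QY.
  by move->.
by move->; apply: (pair_oppr PQ').
Qed.

Lemma pair_uniqr (E : finType) (P Q Q' : {set svec E}) :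
  dual_pair P Q -> dual_pair P Q' -> Q = Q'.
Proof.
by move=> PQ PQ'; apply/eqP; rewrite eqEsubset !(@pair_uniqr_sub E P).
Qed.

Section Dual.
Variables (E : finType) (M : oriented_matroid E).
Implicit Types (X Y Z : svec E) (I J B S D : {set E}).

Definition dual : oriented_matroid E := om_of_pair (oriented_matroid_pair M).

Lemma cocircuits_dual : cocircuits dual = circuits M.
Proof.
apply: pair_uniqr (oriented_matroid_pair dual) _.
exact/dual_pair_sym/oriented_matroid_pair.
Qed.

Lemma cocircuit_basis Y B : Y \in cocircuits M -> basis M B ->
  exists2 x, x \in supp Y & x \in B.
Proof. by rewrite inE => /andP[hY _]; apply: ucocircuit_basis. Qed.

Lemma fundamental_circuit B e : basis M B -> e \notin B ->
  exists2 X, X \in circuits M & e \in supp X /\ supp X \subset e |: B.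
Proof.
move=> bB eB; have [|/indepPn[X MX XB]] := boolP (indep M (e |: B)).
  move=> /(basis_max bB)/(_ (subsetU1 _ _))/setP/(_ e).
  by rewrite setU11 (negPf eB).
by exists X => //; split=> //; apply: circuit_mem (basis_indep bB) MX XB.
Qed.

Lemma dual_indepP I :
  reflect (exists2 B, basis M B & [disjoint I & B]) (indep dual I).
Proof.
apply: (iffP idP) => [iI|[B bB IB]]; last first.
  apply/indepP=> Y DY; apply/negP=> YI.
  have [x xY xB] := cocircuit_basis DY bB.
  by rewrite (disjointFr IB) // (subsetP YI) in xB.
have [|J /maxsetP[/andP[iJ JI] maxJ] _] :=
  @maxset_exists _ [pred J | indep M J && (J \subset ~: I)] set0.
  by rewrite /= indep0 sub0set.
have depI x : x \notin I -> x \notin J -> ~~ indep M (x |: J).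
  move=> xI xJ; apply/negP=> ixJ.
  have := maxJ (x |: J); rewrite /= ixJ subUset sub1set in_setC xI JI subsetU1.
  by move=> /(_ isT isT)/setP/(_ x); rewrite setU11 (negPf xJ).
exists J; last by rewrite disjoint_sym disjoints_subset.
have dep x : x \notin J -> ~~ indep M (x |: J).
  have [xI xJ|] := boolP (x \in I); last exact: depI.
  (* In the second case [Y] is not contained in [I], so it has an element [y] outside [I] and [J];
     the circuit that [y] closes with [J] would meet [Y] in [y] alone. *)
  have [[X MX [xX XJ]]|[Y DY [xY YJ]]] :=
    pair_two_colours (oriented_matroid_pair M) xJ.
    by apply/indepPn; exists X.
  have /subsetPn[y yY yI] := indepP _ _ iI Y DY.
  have yJ : y \notin J by rewrite (disjointFr YJ yY).
  have /indepPn[X MX XJ] := depI y yI yJ.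
  have yX := circuit_mem iJ MX XJ.
  case: (orthogonal_card1F (pair_orthogonal (oriented_matroid_pair M) MX DY) yX yY).
  move=> z zX zY; have := subsetP XJ z zX.
  by rewrite in_setU1 (disjointFr YJ zY) orbF => /eqP.
apply/maxsetP; split=> // K iK JK; apply/eqP; rewrite eqEsubset JK andbT.
apply/subsetP=> x xK; apply/idPn=> /dep/negP[]; apply: indepS iK.
by rewrite subUset sub1set xK.
Qed.

Lemma dual_basis B : basis dual B = basis M (~: B).
Proof.
have sub K : basis M K -> basis dual (~: K).
  move=> bK; apply/maxsetP; split.
    by apply/dual_indepP; exists K; rewrite // disjoints_subset.
  move=> L /dual_indepP[K' bK' LK'] KL; apply/eqP; rewrite eqEsubset KL andbT.
  have K'K : K' \subset K.
    rewrite -setCS; apply: subset_trans KL _.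
    by rewrite -disjoints_subset.
  by rewrite (basis_max bK' (basis_indep bK) K'K) -disjoints_subset.
apply/idP/idP=> [bB|/sub]; last by rewrite setCK.
have /dual_indepP[K bK] := basis_indep bB; rewrite disjoints_subset => BK.
by rewrite -(basis_max bB (basis_indep (sub K bK)) BK) setCK.
Qed.

Lemma rank_dual : rank dual + rank M = #|E|.
Proof.
have [B bB _] := basis_exists (indep0 M).
rewrite (rank_basis bB) (@rank_basis _ dual (~: B)) ?dual_basis ?setCK //.
by rewrite addnC cardsC.
Qed.

Lemma ucocircuitsE : ucocircuits M = @supp E @: cocircuits M.
Proof.
apply/setP=> D; apply/idP/imsetP=> [hD|[Y + ->]]; last by rewrite inE => /andP[].
have : ~~ indep dual D.
  apply/dual_indepP=> -[B bB DB]; have [x xD xB] := ucocircuit_basis hD bB.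
  by rewrite (disjointFr DB xD) in xB.
case/indepPn=> Y DY YD; exists Y => //.
move: hD DY; rewrite !inE => /minsetP[_ minD] /andP[/minsetP[hY _] _].
by rewrite (minD _ hY YD).
Qed.

End Dual.

(** * Deletion and contraction of one element *)

Lemma min_supportP (T : finType) (C : {set svec T}) (X : svec T) :
  reflect (X \in C /\ forall X', X' \in C -> supp X' \subset supp X ->
             supp X' = supp X)
          (X \in min_support C).
Proof.
rewrite inE; apply: (iffP andP) => -[CX minX]; split=> //.
  move=> X' CX' sub; case/minsetP: minX => _; apply=> //=; exact: imset_f.
apply/minsetP; split; first exact: imset_f.
by move=> _ /imsetP[X' CX' ->]; apply: minX.
Qed.

Section RestrictedPair.
Variable E : finType.
Implicit Types (X Y Z : svec (option E)) (P Q C : {set svec (option E)}).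

Lemma restr_vopp X : restr (vopp X) = vopp (restr X).
Proof. by apply/ffunP=> x; rewrite !ffunE. Qed.

Lemma supp_restr X x : (x \in supp (restr X)) = (Some x \in supp X).
Proof. by rewrite !inE ffunE. Qed.

Lemma orthogonal_restr X Y : None \notin supp X \/ None \notin supp Y ->
  orthogonal X Y -> orthogonal (restr X) (restr Y).
Proof.
move=> noN /orthogonalP[oXY eXY].
have some y b c : X y = Some b -> Y y = Some c -> exists z, y = Some z.
  case: y => [z|] Xy Yy; first by exists z.
  by case: noN; rewrite ?(Some_supp Xy) ?(Some_supp Yy).
apply/orthogonalP; split=> x s; rewrite !ffunE => Xx Yx.
  have [y [b [Xy Yy]]] := oXY (Some x) s Xx Yx.
  have [z yz] := some y _ _ Xy Yy.
  by exists z, b; rewrite !ffunE -yz.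
have [y [b [Xy Yy]]] := eXY (Some x) s Xx Yx.
have [z yz] := some y _ _ Xy Yy.
by exists z, b; rewrite !ffunE -yz.
Qed.

Definition deletion P : {set svec E} := [set restr X | X in P & None \notin supp X].

Definition contraction P : {set svec E} :=
  min_support [set restr X | X in P & supp (restr X) != set0].

Lemma deletionP P (X : svec E) :
  reflect (exists2 X', X' \in P & None \notin supp X' /\ X = restr X')
          (X \in deletion P).
Proof.
apply: (iffP imsetP) => [[X' /setIdP[PX' NX'] ->]|[X' PX' [NX' ->]]].
  by exists X'.
by exists X'; rewrite // inE PX'.
Qed.

Lemma contractionP P (X : svec E) :
  reflect ((exists2 X', X' \in P & X = restr X') /\ supp X != set0 /\
           forall X', X' \in P -> supp (restr X') != set0 ->
             supp (restr X') \subset supp X -> supp (restr X') = supp X)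
          (X \in contraction P).
Proof.
apply: (iffP (min_supportP _ _)).
  move=> [/imsetP[X' /setIdP[PX' nX'] ->] minX]; split; first by exists X'.
  split=> // X2 PX2 nX2; apply: minX; apply/imsetP; exists X2 => //.
  by rewrite inE PX2.
move=> [[X' PX' ->] [nX' minX]]; split.
  by apply/imsetP; exists X'; rewrite // inE PX'.
by move=> _ /imsetP[X2 /setIdP[PX2 nX2] ->]; apply: minX.
Qed.

Lemma contraction_below P X : X \in P -> supp (restr X) != set0 ->
  exists2 Y : svec E, Y \in contraction P & supp Y \subset supp (restr X).
Proof.
move=> PX nX; set C := [set restr X | X in P & supp (restr X) != set0].
have CX : restr X \in C by apply: imset_f; rewrite inE PX.
have [|S minS SX] := @minset_exists _ [pred S | S \in @supp E @: C] (supp (restr X)).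
  exact: imset_f.
have /minsetP[/imsetP[Y CY sY] _] := minS.
by exists Y; rewrite -?sY // inE CY -sY.
Qed.

(** Minimality need only be tested among vectors through [Some e]: if a smaller one missed [Some e],
    eliminating from [Y] an element of it, while keeping [Some e], would give a smaller one through
    [Some e]. *)
Lemma contraction_mem P Q Y e : dual_pair P Q -> Y \in Q -> Some e \in supp Y ->
  (forall Z, Z \in Q -> Some e \in supp Z ->
    supp (restr Z) \subset supp (restr Y) -> supp (restr Z) = supp (restr Y)) ->
  restr Y \in contraction Q.
Proof.
move=> PQ QY eY minY; apply/contractionP; split; first by exists Y.
split=> [|Z QZ nZ ZY]; first by apply/set0Pn; exists e; rewrite supp_restr.
have [eZ|eZ] := boolP (Some e \in supp Z); first exact: minY.
have [f fZ] := set0Pn _ nZ; have fY := subsetP ZY f fZ.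
rewrite !supp_restr in fZ fY.
have [Y1 QY1 [sY1 Y1f]] := opp_closed_sign true (pair_oppr PQ) QY fY.
have [Z1 QZ1 [sZ1 Z1f]] := opp_closed_sign false (pair_oppr PQ) QZ fZ.
rewrite -sY1 in eY; rewrite -sZ1 in eZ; have [s Y1e] := suppP _ _ eY.
have Z1e : Z1 (Some e) = None by move: eZ; rewrite inE; case: (Z1 _).
have ef : Some e != Some f.
  by apply: contraNneq eZ => ->; rewrite (Some_supp Z1f).
have [|||W QW [We Wf WYZ]] :=
  pair_elim (a := true) (s := s) PQ QY1 QZ1 Y1f Z1f ef.
- by left.
- by rewrite Y1e => -[]; case: (s).
- by rewrite Z1e.
have WY : supp (restr W) \subset supp (restr Y).
  apply/subsetP=> x; rewrite supp_restr => /suppP[b /WYZ[]/Some_supp].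
    by rewrite sY1 supp_restr.
  by rewrite sZ1 -supp_restr => /(subsetP ZY).
have := minY W QW (Some_supp We) WY.
by move/setP/(_ f); rewrite !supp_restr fY inE Wf.
Qed.

Lemma deletion_contraction_pair P Q :
  dual_pair P Q -> dual_pair (deletion P) (contraction Q).
Proof.
move=> PQ; split=> [X|Y|X|Y|X X'|Y Y'|X Y|S e eS].
- case/deletionP=> X' PX' [NX' ->]; apply/deletionP; exists (vopp X').
    exact: (pair_oppl PQ).
  by rewrite supp_vopp restr_vopp.
- case/contractionP=> -[Y' QY' ->] [nY minY]; apply/contractionP.
  rewrite supp_vopp; split=> //; exists (vopp Y'); first exact: (pair_oppr PQ).
  by rewrite restr_vopp.
- case/deletionP=> X' PX' [NX' ->].
  have [[x|] xX'] := set0Pn _ (pair_neq0l PQ PX'); last by rewrite xX' in NX'.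
  by apply/set0Pn; exists x; rewrite supp_restr.
- by case/contractionP=> _ [].
- case/deletionP=> X1 PX1 [NX1 ->] /deletionP[X2 PX2 [NX2 ->]] sub.
  apply/setP=> x; rewrite !supp_restr; move: x.
  suff sX : supp X1 = supp X2 by move=> x; rewrite sX.
  apply: (pair_antichainl PQ) => //; apply/subsetP=> -[x|] xX.
    by rewrite -supp_restr (subsetP sub) // supp_restr.
  by rewrite xX in NX1.
- case/contractionP=> -[Y1 QY1 ->] [nY1 minY1] /contractionP[_ [_ minY']] sub.
  exact: minY'.
- case/deletionP=> X1 PX1 [NX1 ->] /contractionP[[Y1 QY1 ->] _].
  by apply: orthogonal_restr; [left|apply: pair_orthogonal PQ _ _ PX1 QY1].
(* The new element is not in the circuit colour: a circuit found here survives deletion, while a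
   cocircuit may use the new element and is shrunk to a minimal restriction through [e]. *)
- have [|[X PX [eX XS]]|[Y0 QY0 [eY0 Y0S]]] :=
    pair_two_colours PQ (S := Some @: S) (e := Some e).
  + by rewrite mem_imset //; apply: Some_inj.
  + left; exists (restr X).
      apply/deletionP; exists X => //; split=> //.
      apply/negP=> /(subsetP XS); rewrite in_setU1 /=.
      by case/imsetP.
    split; first by rewrite supp_restr.
    apply/subsetP=> x; rewrite supp_restr => /(subsetP XS).
    rewrite !in_setU1 mem_imset; last exact: Some_inj.
    by rewrite (inj_eq Some_inj).
  + right.
    pose good Y := [&& Y \in Q, Some e \in supp Y & [disjoint supp (restr Y) & S]].
    have goodY0 : good Y0.
      rewrite /good QY0 eY0; apply/pred0P=> x /=; rewrite supp_restr.
      apply/andP=> -[xY xS]; have := disjointFr Y0S xY.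
      by rewrite mem_imset ?xS //; apply: Some_inj.
    case: (arg_minnP (fun Y => #|supp (restr Y)|) goodY0) => Y.
    move=> /and3P[QY eY YS] minY.
    exists (restr Y); last by rewrite supp_restr.
    apply: (contraction_mem PQ QY eY) => Z QZ eZ ZY.
    apply/eqP; rewrite eqEcard ZY minY // /good QZ eZ.
    exact: disjointWl YS.
Qed.

End RestrictedPair.

Section DeletionContraction.
Variables (E : finType) (M : oriented_matroid E) (N : oriented_matroid (option E)).

Lemma contraction_circuitsE :
  circuits M = contraction_circuits N <-> cocircuits M = deletion (cocircuits N).
Proof.
have MM := oriented_matroid_pair M; have NN := oriented_matroid_pair N.
have DC := deletion_contraction_pair (dual_pair_sym NN).
split=> MN.
  by apply: pair_uniqr MM _; apply: dual_pair_sym; rewrite MN.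
by apply: pair_uniqr (dual_pair_sym MM) _; rewrite MN.
Qed.

End DeletionContraction.

(** * Triangulating signatures and liftings *)

Section LiftVectors.
Variables (E : finType).
Implicit Types (X : svec E) (Z : svec (option E)).

Definition add_coord X (s : sign) : svec (option E) :=
  [ffun x => if x is Some y then X y else s].

Lemma restr_add_coord X s : restr (add_coord X s) = X.
Proof. by apply/ffunP=> x; rewrite !ffunE. Qed.

Lemma add_coord_restr Z : add_coord (restr Z) (Z None) = Z.
Proof. by apply/ffunP=> -[x|]; rewrite !ffunE. Qed.

Lemma None_supp_add_coord X s : (None \in supp (add_coord X s)) = (s != None).
Proof. by rewrite inE ffunE. Qed.

End LiftVectors.

Section Signature.
Variables (E : finType) (M : oriented_matroid E) (sigma : svec E -> bool).
Hypothesis gen_sigma : generic_circuit_signature M sigma.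
Implicit Types (X : svec E) (Z : svec (option E)) (B D : {set E}).

Let V X : svec (option E) := add_coord X (Some (sigma X)).

Lemma lift_vector_vopp X : X \in circuits M -> V (vopp X) = vopp (V X).
Proof.
by move=> MX; apply/ffunP=> -[x|]; rewrite !ffunE //= gen_sigma.
Qed.

Lemma circuit_sigma X s : X \in circuits M ->
  exists2 X', X' \in circuits M & supp X' = supp X /\ sigma X' = s.
Proof.
move=> MX; have [sX|sX] := eqVneq (sigma X) s; first by exists X.
exists (vopp X); first exact: circuits_opp.
by rewrite supp_vopp gen_sigma //; case: (sigma X) (s) sX => [] [].
Qed.

Lemma chosenE X : X \in circuits M -> sigma X -> chosen (circuits M) sigma (supp X) = X.
Proof.
move=> MX sX; rewrite /chosen; case: pickP => [X' /and3P[MX' /eqP sXX' sX']|/(_ X)] /=.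
  have [|//|X'E] := circuits_incomp MX' MX; first by rewrite sXX'.
  by move: sX'; rewrite X'E gen_sigma ?sX.
by rewrite MX sX eqxx.
Qed.

Lemma mem_sig_set B X e b : basis M B -> X \in circuits M -> sigma X ->
  supp X \subset e |: B ->
  ((e, b) \in sig_set (circuits M) sigma B) = (e \in B) || (X e == Some b).
Proof.
move=> bB MX sX XB; rewrite inE /=; have [//|eB] := boolP (e \in B).
suff -> : fundamental (circuits M) B e = supp X by rewrite chosenE.
rewrite /fundamental; case: pickP => [D /andP[/imsetP[X' MX' ->] X'B]|/(_ (supp X))] /=.
  exact: fundamental_circuit_uniq (basis_indep bB) MX' MX X'B XB.
by rewrite XB imset_f.
Qed.

(* Up to sign [Z] is determined off [B] by [sig_set B]: it is the signed
   cocircuit that a lifting inducing [sigma] must have there. *)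
Definition cell B Z := [/\ Z None != None,
  forall e, (Some e \in supp Z) = (e \notin B) &
  forall X, X \in circuits M -> orthogonal (V X) Z].

Lemma cell_vopp B Z : cell B Z -> cell B (vopp Z).
Proof.
move=> [ZN ZB oZ]; split=> [|e|X MX].
- by move: ZN; rewrite ffunE; case: (Z None).
- by rewrite supp_vopp.
- exact/orthogonal_vopp/oZ.
Qed.

(** Normalise the cell to - at the new element and take [sigma X] to be +. An opposition is then
    present, and orthogonality asks for an agreement on [E], that is, for an element of [vopp X]
    outside the set of [B]. Conversely the cell has the signs of that set, because the lifted
    fundamental circuit of [e] meets it only in [e] and the new element. *)
Lemma triangulatingP :
  triangulating_circuit_signature M sigma <->
  (forall B, basis M B -> exists Z, cell B Z).
Proof.
split=> [tri B bB|cells B bB D /imsetP[X0 MX0 ->]]; last first.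
  have [Z0 cellZ0] := cells B bB.
  have [Z [[ZN ZB oZ] Zf]] : exists Z, cell B Z /\ Z None = Some false.
    have [ZN _ _] := cellZ0; case Z0N: (Z0 None) ZN => [[]|//] _.
      by exists (vopp Z0); split; [apply: cell_vopp|rewrite ffunE Z0N].
    by exists Z0.
  have [X MX [<- sX]] := circuit_sigma true MX0.
  rewrite chosenE //; apply/negP=> /subsetP sub.
  have /orthogonalP[_ eqv] := oZ X MX.
  have [||[e|] [b [Xe Ze]]] := eqv None true.
  - by rewrite ffunE sX.
  - by [].
  - rewrite ffunE in Xe; have eB : e \notin B by rewrite -ZB (Some_supp Ze).
    have [F0 MF0 [eF0 F0B]] := fundamental_circuit bB eB.
    have [F MF [sF sgF]] := circuit_sigma true MF0; rewrite -sF in F0B.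
    have := sub (e, ~~ b); rewrite inE ffunE Xe eqxx => /(_ isT).
    rewrite (mem_sig_set _ bB MF sgF F0B) (negPf eB) /= => /eqP Fe.
    have /orthogonalP[_ eqF] := oZ F MF.
    have [||[f|] [c [Ff Zf']]] := eqF None true.
    + by rewrite ffunE sgF.
    + by [].
    + rewrite ffunE in Ff; have := subsetP F0B f (Some_supp Ff).
      rewrite in_setU1 -[f \in B]negbK -ZB (Some_supp Zf') orbF => /eqP fe.
      by move: Ff Zf'; rewrite fe Fe Ze => -[<-] []; case: (b).
    + by move: Ff Zf'; rewrite ffunE sgF Zf => -[<-].
  - by move: Xe Ze; rewrite ffunE sX Zf => -[<-].
pose ch e := chosen (circuits M) sigma (fundamental (circuits M) B e).
pose Z : svec (option E) :=
  [ffun x => if x is Some e then if e \in B then None else ch e e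
             else Some false].
have ZB e : (Some e \in supp Z) = (e \notin B).
  rewrite inE ffunE; have [//|eB] := boolP (e \in B).
  have [F0 MF0 [eF0 F0B]] := fundamental_circuit bB eB.
  have [F MF [sF sgF]] := circuit_sigma true MF0.
  have [b Fe] : exists b, F e = Some b by apply/suppP; rewrite sF.
  have := mem_sig_set b bB MF sgF; rewrite sF => /(_ e F0B).
  by rewrite inE /= (negPf eB) Fe eqxx => /eqP; rewrite /ch => ->.
exists Z; split=> [|//|X MX]; first by rewrite ffunE.
wlog sX : X MX / sigma X.
    move=> wl; have [|nsX] := boolP (sigma X); first exact: wl.
    rewrite -[X]voppK lift_vector_vopp ?circuits_opp //; apply: orthogonal_voppl.
    by apply: wl; rewrite ?circuits_opp ?gen_sigma.
  have /subsetPn[[e b]] := tri B bB (supp X) (imset_f _ MX).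
  rewrite chosenE // inE ffunE /= => /eqP Xe; rewrite inE /= negb_or => /andP[eB].
  rewrite -/(ch e) => nch.
  have {}Xe : X e = Some (~~ b) by move: Xe; case: (X e) => [[]|] //= [<-].
  have Ze : Z (Some e) = Some (~~ b).
    move: nch; have := ZB e; rewrite eB inE ffunE (negPf eB).
    by case: (ch e e) (b) => [[]|] [].
  apply/orthogonalP; split=> [x s|x s] Vx Zx.
    by exists None, true; rewrite !ffunE sX.
  by exists (Some e), (~~ b); rewrite Ze ffunE Xe.
Qed.

(** * Cells from a given generic lifting *)

Section Lifting.
Variable N : oriented_matroid (option E).
Hypotheses (liftN : generic_lifting M N) (indN : induced_by_lifting M N sigma).

Let NN := oriented_matroid_pair N.

Let contracted (X : svec (option E)) : X \in circuits N -> supp (restr X) != set0 ->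
  exists2 Y, Y \in circuits M & supp Y \subset supp (restr X).
Proof.
by have [[_ ->] _] := liftN; apply: contraction_below.
Qed.

Lemma lifting_cell B : basis M B -> exists Z, cell B Z.
Proof.
move=> bB; have [[rN cN] genN] := liftN.
have NB : None \notin Some @: B by apply/imsetP=> -[].
have [[X NX [XN XB]]|[Z NZ [ZN ZB]]] := pair_two_colours NN NB.
  have [X0|nX] := eqVneq (supp (restr X)) set0; last first.
    have [Y MY YX] := contracted NX nX.
    have /indepP/(_ Y MY)/negP[] := basis_indep bB.
    apply: subset_trans YX _; apply/subsetP=> x; rewrite supp_restr.
    move=> /(subsetP XB); rewrite in_setU1 /= mem_imset //; exact: Some_inj.
  (* The rank excludes a loop at the new element: a basis of [N] would then be a subset of [E]
     larger than [rank M], and the circuit of [M] inside it would come from a circuit of [N] inside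
     that basis. *)
  have sX : supp X = [set None].
    apply/setP=> -[x|]; last by rewrite XN set11.
    by rewrite -supp_restr X0 !inE.
  have [K bK _] := basis_exists (indep0 N).
  have NK : None \notin K.
    apply/negP=> KN; have /indepP/(_ X NX)/negP[] := basis_indep bK.
    by rewrite sX sub1set.
  pose I := [set x | Some x \in K].
  have KI : K = Some @: I.
    apply/setP=> -[x|]; first by rewrite mem_imset ?inE //; apply: Some_inj.
    by rewrite (negPf NK); apply/esym/imsetP=> -[].
  have [|Y MY YI] := @indepPn _ M I _.
    apply/negP=> /indep_leq_rank; rewrite -ltnS -rN (rank_basis bK) KI.
    by rewrite card_imset ?ltnn //; apply: Some_inj.
  move: MY YI; rewrite cN => /contractionP[[X' NX' ->] [nX' _]] X'I.
  have NX'N : None \notin supp X'.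
    apply: contra nX' => X'N.
    have sXX' : supp X = supp X'.
      by apply: (pair_antichainl NN) => //; rewrite sX sub1set.
    by apply/eqP/setP=> x; rewrite supp_restr -sXX' -supp_restr X0.
  have /indepP/(_ X' NX')/negP[] := basis_indep bK.
  apply/subsetP=> -[x|] xX'; last by rewrite xX' in NX'N.
  by have := subsetP X'I x; rewrite supp_restr xX' inE => ->.
(* Genericity makes the zero set of [Z] independent; a cocircuit meets every basis, so this set is
   no basis of [N]. It thus has at most [rank M] elements and equals the copy of [B] that it
   contains. *)
have uZ : supp Z \in ucocircuits N by rewrite ucocircuitsE imset_f.
have iZ := genN _ uZ ZN.
have BZ : Some @: B = ~: supp Z.
  apply/eqP; rewrite eqEcard -disjoints_subset disjoint_sym ZB.
  rewrite card_imset; last exact: Some_inj.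
  rewrite -ltnS -(rank_basis bB) -rN ltn_neqAle indep_leq_rank // andbT.
  apply/eqP=> /(indep_basis iZ)/(ucocircuit_basis uZ)[x xZ].
  by rewrite in_setC xZ.
exists Z; split=> [|e|X MX].
- by move: ZN; rewrite inE.
- rewrite -[_ \in supp Z]negbK -in_setC -BZ mem_imset //; exact: Some_inj.
- have [X' [[NX' XX'] _] X'N] := indN MX.
  suff -> : V X = X' by apply: (pair_orthogonal NN).
  by rewrite -[X']add_coord_restr XX' X'N.
Qed.

End Lifting.

(** * A generic lifting from the cells *)

Section Construction.
Hypothesis cells : forall B, basis M B -> exists Z, cell B Z.

Definition lift_cocircuits : {set svec (option E)} :=
  [set Z : svec (option E) | if Z None is Some _ then
    basis M [set e | Some e \notin supp Z] &&
    [forall X in circuits M, orthogonal (V X) Z]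
  else restr Z \in cocircuits M].

Let Q := lift_cocircuits.

Let MM := oriented_matroid_pair M.

Lemma lift_cocircuitsP Z : reflect
  ((Z None = None /\ restr Z \in cocircuits M) \/
   (exists2 B, basis M B & cell B Z)) (Z \in Q).
Proof.
rewrite [Z \in Q]in_set; case ZN: (Z None) => [s|]; last first.
  apply: (iffP idP) => [MZ|[[_ //]|[B _ []]]]; first by left.
  by rewrite ZN.
apply: (iffP andP) => [[bB /forall_inP oZ]|[[//]|[B bB [_ ZB oZ]]]].
  right; exists [set e | Some e \notin supp Z] => //; split=> // [|e].
    by rewrite ZN.
  by rewrite inE negbK.
suff -> : [set e | Some e \notin supp Z] = B by split=> //; apply/forall_inP.
by apply/setP=> e; rewrite inE ZB negbK.
Qed.

Let cocircuit_mem Y : Y \in cocircuits M -> add_coord Y None \in Q.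
Proof.
move=> MY; apply/lift_cocircuitsP; left.
by rewrite ffunE restr_add_coord.
Qed.

Let cell_mem B Z : basis M B -> cell B Z -> Z \in Q.
Proof. by move=> bB cZ; apply/lift_cocircuitsP; right; exists B. Qed.

Let orthogonalQ X Z : X \in circuits M -> Z \in Q -> orthogonal (V X) Z.
Proof.
move=> MX /lift_cocircuitsP[[ZN MZ]|[B _ [_ _]]]; last exact.
have [oXZ eXZ] := orthogonalP _ _ (pair_orthogonal MM MX MZ).
apply/orthogonalP; split=> -[x|] s; rewrite ?ZN // ffunE => Xx Zx.
  have [|y [b [Xy Zy]]] := oXZ x s Xx; first by rewrite ffunE.
  by rewrite ffunE in Zy; exists (Some y), b; rewrite ffunE.
have [|y [b [Xy Zy]]] := eXZ x s Xx; first by rewrite ffunE.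
by rewrite ffunE in Zy; exists (Some y), b; rewrite ffunE.
Qed.

Let opp_closedQ : opp_closed Q.
Proof.
move=> Z /lift_cocircuitsP[[ZN MZ]|[B bB cZ]].
  apply/lift_cocircuitsP; left; rewrite ffunE ZN restr_vopp; split=> //.
  exact: (pair_oppr MM).
by apply: (cell_mem bB); apply: cell_vopp.
Qed.

Let neq0Q Z : Z \in Q -> supp Z != set0.
Proof.
move=> /lift_cocircuitsP[[_ /(pair_neq0r MM)/set0Pn[x]]|[B _ [ZN _ _]]].
  by rewrite supp_restr => xZ; apply/set0Pn; exists (Some x).
by apply/set0Pn; exists None; rewrite inE.
Qed.

Let cell_pair B e : basis M B -> e \notin B -> exists2 X, X \in circuits M &
  e \in supp X /\ forall Z y, cell B Z -> y \in supp (V X) -> y \in supp Z ->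
    (y == None) || (y == Some e).
Proof.
move=> bB eB; have [X MX [eX XB]] := fundamental_circuit bB eB.
exists X => //; split=> // Z [y|//] [_ ZB _] yX; rewrite ZB => yB /=.
have yX' : y \in supp X by move: yX; rewrite !inE ffunE.
by have := subsetP XB y yX'; rewrite in_setU1 (negPf yB) orbF => /eqP->.
Qed.

(** A lifted fundamental circuit of [B] meets a cell over [B] only in its own element and the new
    one, so the sign at the new element determines all others. *)
Let cell_uniq B Z Z' : basis M B -> cell B Z -> cell B Z' -> Z None = Z' None ->
  Z = Z'.
Proof.
move=> bB cZ cZ' ZN; have [nZ ZB oZ] := cZ; have [nZ' Z'B oZ'] := cZ'.
apply: svec_eq => [|[x|] b Zx]; last by rewrite -ZN.
  by apply/setP=> -[x|]; rewrite ?ZB ?Z'B // !inE nZ nZ'.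
have xB : x \notin B by rewrite -ZB (Some_supp Zx).
have [c Z'x] : exists c, Z' (Some x) = Some c by apply/suppP; rewrite Z'B.
have [X MX [/suppP[a Xx] meet]] := cell_pair bB xB.
have Vx : V X (Some x) = Some a by rewrite ffunE.
have VN : V X None = Some (sigma X) by rewrite ffunE.
have [d ZNd] : exists d, Z None = Some d by apply/suppP; rewrite inE.
have sw (W : svec (option E)) : cell B W -> forall y, y \in supp (V X) ->
    y \in supp W -> (y == Some x) || (y == None).
  by move=> cW y yX yW; rewrite orbC; apply: (meet W y cW).
rewrite (orthogonal_meet2 (oZ X MX) (sw Z cZ) Vx VN Zx ZNd) Z'x.
have Z'N := etrans (esym ZN) ZNd.
by rewrite (orthogonal_meet2 (oZ' X MX) (sw Z' cZ') Vx VN Z'x Z'N).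
Qed.

Let incompQ Z Z' : Z \in Q -> Z' \in Q -> supp Z \subset supp Z' ->
  Z = Z' \/ Z = vopp Z'.
Proof.
move=> /lift_cocircuitsP[[ZN MZ]|[B bB cZ]];
  move=> /lift_cocircuitsP[[Z'N MZ']|[B' bB' cZ']] sub.
- have [|eZ|eZ] := @pair_incomp _ _ _ MM _ _ MZ MZ'.
  + by apply/subsetP=> x; rewrite !supp_restr; apply: (subsetP sub).
  + by left; rewrite -(add_coord_restr Z) eZ ZN -Z'N add_coord_restr.
  + right; rewrite -(add_coord_restr Z) eZ -restr_vopp.
    by rewrite -[RHS]add_coord_restr ffunE Z'N ZN.
- have [x xZ xB'] := cocircuit_basis MZ bB'; have [_ Z'B' _] := cZ'.
  by have := subsetP sub (Some x); rewrite -supp_restr xZ Z'B' xB' => /(_ isT).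
- by have [ZN _ _] := cZ; have := subsetP sub None; rewrite !inE ZN Z'N => /(_ isT).
- have [ZN ZB _] := cZ; have [Z'N Z'B _] := cZ'.
  have B'B : B' \subset B.
    apply/subsetP=> x; apply: contraLR; rewrite -ZB -Z'B; exact: (subsetP sub).
  rewrite -{}(basis_max bB' (basis_indep bB) B'B) in cZ'.
  have [|neq] := eqVneq (Z None) (Z' None); first by left; apply: cell_uniq cZ cZ' _.
  right; apply: cell_uniq cZ (cell_vopp cZ') _ => //.
  rewrite ffunE; case: (Z None) (Z' None) ZN Z'N neq => [[]|] // [[]|] //.
Qed.

(** Two-colouring suffices: an independent colour class extends to a basis, over which a cell
    vanishes on the class; a dependent one contains a circuit, signed so that [sigma] has the
    required value. *)
Let painting_None (A : E -> bool -> bool) s :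
  (exists2 X, X \in circuits M &
     sigma X = s /\ forall x b, X x = Some b -> A x b) \/
  (exists2 Z, Z \in Q &
     Z None = Some s /\ forall x b, Z (Some x) = Some b -> ~~ A x (~~ b)).
Proof.
have paint : painting_at [set V X | X in circuits M]
    [set Z in Q | None \in supp Z] None.
  apply: painting_of_two_colours => [_ Z /imsetP[X MX ->] /setIdP[QZ _]|S t NS].
    exact: orthogonalQ.
  have [/basis_exists[B bB SB]|/indepPn[X0 MX0 X0S]] :=
      boolP (indep M [set x | Some x \in S]).
    right; have [Z0 cZ0] := cells bB.
    have [Z cZ ZN] : exists2 Z, cell B Z & Z None = Some t.
      have [ZN _ _] := cZ0; case Z0N: (Z0 None) ZN => [u|//] _.
      have [ut|ut] := eqVneq u t; first by exists Z0; rewrite ?Z0N ?ut.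
      exists (vopp Z0); first exact: cell_vopp.
      by rewrite ffunE Z0N; case: (u) (t) ut => [] [].
    exists Z; first by rewrite inE (cell_mem bB) // (Some_supp ZN).
    split=> //; rewrite disjoint_subset; apply/subsetP=> -[x|] xZ; rewrite inE //.
    have [_ ZB _] := cZ; rewrite ZB in xZ; apply: contra xZ => xS.
    by rewrite (subsetP SB) // inE.
  left; have [X MX [sX sgX]] := circuit_sigma t MX0.
  exists (V X); first exact: imset_f.
  rewrite ffunE sgX; split=> //; apply/subsetP=> -[x|] xX; rewrite in_setU1 //=.
  have {}xX : x \in supp X0 by rewrite -sX; move: xX; rewrite !inE ffunE.
  by have := subsetP X0S x xX; rewrite inE.
case: (paint (fun x b => if x is Some y then A y b else true) s).
  move=> [_ /imsetP[X MX ->] [VN XA]]; left; exists X => //; split.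
    by move: VN; rewrite ffunE => -[].
  by move=> x b Xx; apply: (XA (Some x)); rewrite ?ffunE.
by move=> [Z /setIdP[QZ _] [ZN ZA]]; right; exists Z => //; split=> // x b /ZA ->.
Qed.

(* Painting in [M] at an element [f] where [Z1] and [Z2] do not cancel yields
   either the required vector or a circuit [X].  If the new element cancels, [X]
   can only use [e], and a second such circuit, from painting at the new
   element, lets [e] be eliminated while keeping [f]. *)
Let elimQ Z1 Z2 e : Z1 \in Q -> Z2 \in Q -> Z1 <> vopp Z2 ->
  Z1 e = Some true -> Z2 e = Some false ->
  exists2 Z, Z \in Q & Z e = None /\
    forall x b, Z x = Some b -> Z1 x = Some b \/ Z2 x = Some b.
Proof.
move=> QZ1 QZ2 neZ Z1e Z2e.
(* The painting of [pair_elim], restricted to [E]; the sign at the new element is followed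
   separately. *)
pose A x b := (Some x == e) ||
  (Z1 (Some x) != Some (~~ b)) && (Z2 (Some x) != Some (~~ b)).
pose inA X := forall x b, X x = Some b -> A x b.
pose one_signed f s :=
  [/\ Z1 f = Some s \/ Z2 f = Some s, Z1 f <> Some (~~ s) & Z2 f <> Some (~~ s)].
have agree X x b : inA X -> Some x != e -> X x = Some b ->
    Z1 (Some x) <> Some (~~ b) /\ Z2 (Some x) <> Some (~~ b).
  by move=> XA xe /XA; rewrite /A (negPf xe) => /andP[/eqP ? /eqP].
have finish Z : Z \in Q -> (forall x b, Z (Some x) = Some b -> ~~ A x (~~ b)) ->
    (forall b, Z None = Some b -> e != None /\ (Z1 None = Some b \/ Z2 None = Some b)) ->
    exists2 Z, Z \in Q & Z e = None /\
      forall x b, Z x = Some b -> Z1 x = Some b \/ Z2 x = Some b.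
  move=> QZ ZA ZN; exists Z => //; split=> [|[x|] b Zx].
  - case Ze: (Z e) => [b|//]; case eE: e => [x|].
      by rewrite eE in Ze; have := ZA x b Ze; rewrite /A eE eqxx.
    by rewrite eE in Ze; have [] := ZN b Ze; rewrite eE eqxx.
  - have := ZA x b Zx; rewrite negb_or negb_and !negbK => /andP[_].
    by case/orP=> /eqP; [left|right].
  - by have [] := ZN b Zx.
have conflict X f s : X \in circuits M -> inA X -> f != e -> V X f = Some s ->
    Z1 f = Some s \/ Z2 f = Some s ->
    (e != None -> Z1 None <> Some (~~ sigma X) /\ Z2 None <> Some (~~ sigma X)) ->
    False.
  move=> MX XA fe Xf f12 XN.
  apply: (orthogonal_elimF (orthogonalQ MX QZ1) (orthogonalQ MX QZ2)
    Z1e Z2e fe Xf f12) => -[x|] b xe.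
    by rewrite ffunE; apply: agree.
  by rewrite ffunE => -[<-]; apply: XN; rewrite eq_sym.
have neq_e f s : one_signed f s -> f != e.
  move=> [f12 f1 f2]; apply/eqP=> fe; rewrite fe Z1e Z2e in f1 f2.
  by case: s f12 f1 f2.
have at_None s : one_signed None s -> exists2 Z, Z \in Q & Z e = None /\
    forall x b, Z x = Some b -> Z1 x = Some b \/ Z2 x = Some b.
  move=> sN; have [N12 N1 N2] := sN.
  have [[X MX [sX XA]]|[Z QZ [ZN ZA]]] := painting_None A s.
    case: (conflict X None s MX XA) => //; first exact: neq_e sN.
      by rewrite ffunE sX.
    by rewrite sX.
  apply: (finish Z QZ ZA) => b; rewrite ZN => -[<-]; split=> //.
  by rewrite eq_sym; apply: neq_e sN.
have [f [s fs]] : exists f s, one_signed f s.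
  have [f nef|eqZ] := pickP (fun f => Z1 f != vopp Z2 f); last first.
    by case: neZ; apply/ffunP=> f; apply/eqP/negbFE/eqZ.
  move: nef; rewrite ffunE /one_signed; exists f.
  case: (Z1 f) (Z2 f) nef => [b|] [c|] //= bc.
  - by exists b; move: bc; case: b; case: c => // _; split=> //; left.
  - by exists b; split=> //; [left|case: b bc].
  - by exists c; split=> //; [right|case: c bc].
have fe := neq_e f s fs.
case: f => [f|] in fs fe *; last exact: at_None fs.
have [f12 f1 f2] := fs.
have Afs b : A f b -> b = s.
  rewrite /A (negPf fe) => /andP[/eqP b1 /eqP b2]; apply/eqP/idPn=> bs.
  have {}bs : ~~ b = s by case: (b) (s) bs => [] [].
  by rewrite bs in b1 b2; case: f12.
have [[X MX [Xf XA']]|[Y MY [Yf YA]]] := pair_painting f MM A s; last first.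
  apply: (finish (add_coord Y None) (cocircuit_mem MY)) => [x b|b].
    rewrite ffunE => Yx; have [xf|xf] := eqVneq x f; last exact: YA.
    apply/negP; rewrite xf => /Afs bs; move: Yx; rewrite xf Yf -bs => -[].
    by case: (b).
  by rewrite ffunE.
have XA : inA X.
  move=> x b Xx; have [xf|xf] := eqVneq x f; last exact: XA'.
  move: Xx; rewrite xf Xf => -[<-]; rewrite /A (negPf fe) /=.
  by apply/andP; split; apply/eqP.
have VXf X' : X' f = Some s -> V X' (Some f) = Some s by rewrite ffunE.
(* If the new element is the one eliminated, any sign of [V X] is harmless there and orthogonality
   already fails. *)
have [eN|eN] := eqVneq e None.
  by case: (conflict X (Some f) s) => //; [exact: VXf|rewrite eN].
case Z1N: (Z1 None) => [c|]; case Z2N: (Z2 None) => [d|]; first last.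
- case: (conflict X (Some f) s) => //; first exact: VXf.
  by rewrite Z1N Z2N.
- by apply: (at_None d); rewrite /one_signed Z1N Z2N; split=> //; [right|case: d Z2N].
- by apply: (at_None c); rewrite /one_signed Z1N Z2N; split=> //; [left|case: c Z1N].
have [cd|cd] := eqVneq d c.
  by apply: (at_None c); rewrite /one_signed Z1N Z2N cd; split; [left|case: (c)|case: (c)].
have {}cd : d = ~~ c by case: (c) (d) cd => [] [].
rewrite {d}cd in Z2N.
case: e => [e|//] in Z1e Z2e A inA agree finish conflict neq_e at_None fe Afs
  XA XA' eN *.
(* A circuit not using [e] could oppose [Z1] or [Z2] only at the new element, where these two
   cancel; so the new element takes the role of [e] in [orthogonal_elimF]. *)
have avoid_e X' : X' \in circuits M -> inA X' -> X' f = Some s -> X' e <> None.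
  move=> MX' X'A X'f X'e.
  apply: (orthogonal_elimF (orthogonalQ MX' QZ1) (orthogonalQ MX' QZ2)
    Z1N Z2N (f := Some f) (s := s)) => // [|[x|//] b _].
    exact: VXf.
  rewrite ffunE => X'x; apply: (agree X') => //.
  by apply/eqP=> -[xe]; rewrite xe X'e in X'x.
case Xe: (X e) => [a|]; last by case: (avoid_e X).
(* The requested sign is that, at the new element, of whichever of [Z1], [Z2] has sign [a] at [e]. A
   circuit [X3] with this sign must oppose that vector somewhere, which is allowed only at [e]; so
   [X3] and [X] have opposite signs at [e]. *)
have [[X3 MX3 [sX3 X3A]]|[Z QZ [ZN ZA]]] :=
    painting_None A (if a then c else ~~ c); last first.
  apply: (finish Z QZ ZA) => b; rewrite ZN Z1N Z2N => -[<-]; split=> //.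
  by case: (a); [left|right].
have X3e : X3 e = Some (~~ a).
  pose Zi := if a then Z1 else Z2.
  have Zie : Zi (Some e) = Some a by rewrite /Zi; case: (a).
  have ZiN : Zi None = V X3 None.
    by rewrite /Zi ffunE sX3; case: (a).
  have QZi : Zi \in Q by rewrite /Zi; case: (a).
  have VN : V X3 None = Some (sigma X3) by rewrite ffunE.
  have [[x|] [b [Vx Zix]]] :=
    orthogonal_opp (orthogonalQ MX3 QZi) VN (etrans ZiN VN); last first.
    by move: Vx Zix; rewrite ZiN => ->; case: (b).
  rewrite ffunE in Vx; have [[xe]|xe] := eqVneq (Some x) (Some e).
    by move: Zix Vx; rewrite xe Zie => -[->]; rewrite negbK.
  have [] := agree X3 x b X3A xe Vx.
  by move: Zix; rewrite /Zi; case: (a) => Zix; rewrite Zix.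
have ne : f != e by apply: contraNneq fe => ->.
have [|||X2 MX2 [X2f X2e X2X]] :=
  pair_elim (dual_pair_sym MM) MX MX3 Xe X3e ne (s := s).
- by left.
- by rewrite Xf => -[]; case: (s).
- by move=> /X3A/Afs; case: (s).
case: (avoid_e X2) => // x b /X2X[]; [exact: XA|exact: X3A].
Qed.

Let weak_elimQ Z1 Z2 e : Z1 \in Q -> Z2 \in Q -> Z1 <> vopp Z2 ->
  e \in pos Z1 :&: neg Z2 ->
  exists2 Z, Z \in Q & pos Z \subset (pos Z1 :|: pos Z2) :\ e /\
                       neg Z \subset (neg Z1 :|: neg Z2) :\ e.
Proof.
move=> QZ1 QZ2 neZ; rewrite !inE => /andP[/eqP Z1e /eqP Z2e].
have [Z QZ [Ze ZZ]] := elimQ QZ1 QZ2 neZ Z1e Z2e.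
exists Z => //; exact: pos_neg_subset.
Qed.

Let N0 : oriented_matroid (option E) :=
  OrientedMatroid neq0Q opp_closedQ incompQ weak_elimQ.

Let cocircuits_N0 : cocircuits (dual N0) = Q.
Proof. exact: cocircuits_dual. Qed.

(** Dually, a basis of [M] together with the new element is a basis of the lifting; this gives both
    its rank and its genericity. *)
Let basis_N0 B : basis M B -> basis N0 (Some @: ~: B).
Proof.
move=> bB; apply/maxsetP; split=> [|K /indepP iK BK].
  apply/indepP=> Z QZ; apply/negP=> ZB.
  have [[_ MZ]|[B' _ [ZN _ _]]] := lift_cocircuitsP _ QZ.
    have [x xZ xB] := cocircuit_basis MZ bB.
    have := subsetP ZB (Some x); rewrite -supp_restr xZ mem_imset.
      by rewrite inE xB => /(_ isT).
    exact: Some_inj.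
  by have := subsetP ZB None; rewrite inE ZN => /(_ isT)/imsetP[].
have [Z cZ] := cells bB; have [_ ZB _] := cZ.
apply/eqP; rewrite eqEsubset BK andbT; apply/subsetP=> -[x|] xK; last first.
  have /negP[] := iK Z (cell_mem bB cZ); apply/subsetP=> -[y|//].
  by rewrite ZB => yB; rewrite (subsetP BK) // imset_f ?inE.
rewrite imset_f // in_setC; apply/negP=> xB.
have bB' : basis (dual M) (~: B) by rewrite dual_basis setCK.
have [|Y MY [xY YB]] := fundamental_circuit bB' (e := x).
  by rewrite in_setC xB.
have /negP[] := iK _ (cocircuit_mem MY); apply/subsetP=> -[y|].
  rewrite -supp_restr restr_add_coord => /(subsetP YB).
  rewrite in_setU1 => /orP[/eqP->//|yB].
  by rewrite (subsetP BK) // imset_f.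
by rewrite None_supp_add_coord.
Qed.

Lemma cells_lifting : exists N : oriented_matroid (option E),
  generic_lifting M N /\ induced_by_lifting M N sigma.
Proof.
have cM : circuits M = contraction_circuits (dual N0).
  apply/contraction_circuitsE; rewrite cocircuits_N0; apply/setP=> Y.
  apply/idP/deletionP=> [MY|[Z QZ [ZN ->]]].
    exists (add_coord Y None); first exact: cocircuit_mem.
    by rewrite None_supp_add_coord restr_add_coord.
  have [[]//|[B _ [ZN' _ _]]] := lift_cocircuitsP _ QZ.
  by rewrite inE ZN' in ZN.
(* A cell over a basis containing all of [supp X] but one element [e] meets both [Y] and [V X] only
   in [e] and the new element; orthogonality to it forces the same sign at the new element in
   both. *)
have cap_lift X Y : X \in circuits M -> Y \in circuits (dual N0) -> restr Y = X ->
    Y = V X.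
  move=> MX NY YX; have [e eX] := set0Pn _ (circuits_neq0 MX).
  have iX : indep M (supp X :\ e).
    apply/indepP=> X' MX'; apply/negP=> X'X.
    have := subsetP X'X e; rewrite setD11.
    have [|->|->] := circuits_incomp MX' MX; last by rewrite supp_vopp => /(_ eX).
      exact: subset_trans X'X (subD1set _ _).
    by move/(_ eX).
  have [B bB XB] := basis_exists iX.
  have eB : e \notin B.
    apply/negP=> eB; have /indepP/(_ X MX)/negP[] := basis_indep bB.
    by rewrite -(setD1K eX) subUset sub1set eB.
  have [Z cZ] := cells bB; have [ZN ZB oZ] := cZ.
  have QZ := cell_mem bB cZ.
  have meet W : restr W = X -> forall y, y \in supp Z -> y \in supp W ->
      (y == None) || (y == Some e).
    move=> WX [x|//]; rewrite ZB -supp_restr WX => xB xX /=.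
    apply: contraR xB => xe; rewrite (subsetP XB) // in_setD1 xX andbT.
    by apply: contraNneq xe => ->.
  have oZY : orthogonal Z Y.
    exact: (pair_orthogonal (oriented_matroid_pair N0) QZ NY).
  have oZV : orthogonal Z (V X) by rewrite orthogonalC; apply: oZ.
  have VX : restr (V X) = X by apply: restr_add_coord.
  have [t Ze] : exists t, Z (Some e) = Some t by apply/suppP; rewrite ZB.
  have [u ZNu] : exists u, Z None = Some u by apply/suppP; rewrite inE.
  have [v Xe] := suppP _ _ eX.
  have Ye : Y (Some e) = Some v by rewrite -Xe -YX ffunE.
  have Ve : V X (Some e) = Some v by rewrite ffunE.
  have [w YN] : exists w, Y None = Some w.
    apply/suppP/idPn=> YN.
    apply: (orthogonal_card1F oZY (Some_supp Ze) (Some_supp Ye)) => y yZ yY.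
    have /orP[/eqP yN|/eqP//] := meet Y YX y yZ yY.
    by rewrite yN (negPf YN) in yY.
  have VN : V X None = Some (sigma X) by rewrite ffunE.
  rewrite -(add_coord_restr Y) YX YN.
  rewrite (orthogonal_meet2 oZY (meet Y YX) ZNu Ze YN Ye).
  by rewrite -(orthogonal_meet2 oZV (meet (V X) VX) ZNu Ze VN Ve).
exists (dual N0); split.
  split; first split=> //.
    have [B bB _] := basis_exists (indep0 M).
    have := rank_dual N0; rewrite (rank_basis (basis_N0 bB)) (rank_basis bB).
    rewrite card_imset; last exact: Some_inj.
    by rewrite card_option -(cardsC B) -addSn => /addIn.
  move=> D; rewrite ucocircuitsE cocircuits_N0 => /imsetP[Z QZ ->] ZN.
  have [[ZN' _]|[B bB [_ ZB _]]] := lift_cocircuitsP _ QZ.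
    by rewrite inE ZN' in ZN.
  apply/dual_indepP; exists (Some @: ~: B); first exact: basis_N0.
  rewrite disjoint_sym disjoints_subset setCK; apply/subsetP=> _ /imsetP[x xB ->].
  by rewrite ZB -in_setC.
move=> X MX; have : X \in contraction_circuits (dual N0) by rewrite -cM.
case/contractionP=> -[Y NY XY] _; have YV := cap_lift X Y MX NY (esym XY).
exists Y; last by rewrite YV ffunE.
split=> // Y' [NY' Y'X]; by rewrite (cap_lift X Y' MX NY' Y'X).
Qed.

End Construction.

Lemma triangulating_iff_lifting :
  triangulating_circuit_signature M sigma <->
  exists N : oriented_matroid (option E),
    generic_lifting M N /\ induced_by_lifting M N sigma.
Proof.
split=> [/triangulatingP|[N [liftN indN]]]; first exact: cells_lifting.
by apply/triangulatingP; apply: lifting_cell liftN indN.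
Qed.

End Signature.

(** * Extensions *)

Section DualExtension.
Variables (E : finType) (M : oriented_matroid E).
Implicit Types N : oriented_matroid (option E).

Lemma spanning_dual_indep (T : finType) (N : oriented_matroid T) (S : {set T}) :
  spanning N S = indep (dual N) (~: S).
Proof.
apply/spanningP/dual_indepP=> -[B bB BS]; exists B => //.
  by rewrite disjoint_sym disjoints_subset setCK.
by move: BS; rewrite disjoint_sym disjoints_subset setCK.
Qed.

Lemma triangulating_cocircuit_dual sigma :
  triangulating_cocircuit_signature M sigma <->
  triangulating_circuit_signature (dual M) sigma.
Proof.
split=> tri B bB; last by rewrite -[B]setCK -dual_basis in bB; apply: tri.
by rewrite -[B]setCK; apply: tri; rewrite -dual_basis.
Qed.

(** Circuits of [N] through the new element are cocircuits of [dual N], and spanning sets are the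
    complements of dually independent ones. The rank rises by one in the dual because the ground set
    gains an element while the rank of [N] stays that of [M]. *)
Lemma generic_extension_dual N :
  generic_extension M N <-> generic_lifting (dual M) (dual N).
Proof.
have uE : ucocircuits (dual N) = ucircuits N by rewrite ucocircuitsE cocircuits_dual.
have cE : circuits M = deletion_circuits N <->
    circuits (dual M) = contraction_circuits (dual N).
  have := contraction_circuitsE (dual M) (dual N).
  by rewrite !cocircuits_dual; apply: iff_sym.
have rE : rank N = rank M <-> rank (dual N) = (rank (dual M)).+1.
  have := rank_dual M; have := rank_dual N; rewrite card_option => rN rM.
  split=> rMN; apply/eqP.
    by rewrite -(eqn_add2r (rank N)) rN rMN addSn rM.
  by rewrite -(eqn_add2l (rank (dual N))) rN rMN addSn rM.
split=> -[[rMN cMN] gen]; split.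
- by split; [apply/rE|apply/cE].
- by move=> D; rewrite uE -spanning_dual_indep; apply: gen.
- by split; [apply/rE|apply/cE].
- by move=> C; rewrite spanning_dual_indep -uE; apply: gen.
Qed.

(** [dual (dual N)] has the circuits of [N] but other proof components; genericity of a lifting
    depends on the circuits alone. *)
Lemma eq_circuits_generic_lifting N N' :
  circuits N = circuits N' -> generic_lifting M N -> generic_lifting M N'.
Proof.
case: N N' => C p1 p2 p3 p4 [C' q1 q2 q3 q4] /= eqC.
by move: q1 q2 q3 q4; rewrite -eqC.
Qed.

End DualExtension.

Theorem proposition5p3 (E : finType) (M : oriented_matroid E) :
  (forall sigma : svec E -> bool,
     generic_circuit_signature M sigma ->
     (triangulating_circuit_signature M sigma <->
      exists N : oriented_matroid (option E),
        generic_lifting M N /\ induced_by_lifting M N sigma)) /\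
  (forall sigma : svec E -> bool,
     generic_cocircuit_signature M sigma ->
     (triangulating_cocircuit_signature M sigma <->
      exists N : oriented_matroid (option E),
        generic_extension M N /\ induced_by_extension M N sigma)).


Proof.
split=> sigma gen; first exact: triangulating_iff_lifting.
(* The circuits of [dual M] are the cocircuits of [M] by computation, so [gen] serves as it is for
   the dual. *)
apply: iff_trans (triangulating_cocircuit_dual M sigma) _.
apply: iff_trans (@triangulating_iff_lifting _ (dual M) sigma gen) _.
split=> -[N [gN iN]].
  exists (dual N); split; last by rewrite /induced_by_extension cocircuits_dual.
  apply/generic_extension_dual; apply: eq_circuits_generic_lifting gN.
  exact/esym/cocircuits_dual.
by exists (dual N); split=> //; apply/generic_extension_dual.
Qed.
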